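(* For suitably chosen initial conditions, the Darboux transform of a Bianchi quadrilateral is a Bianchi quadrilateral. That is: let $(f,f_1,\hat f,f_2)$ be a Bianchi quadrilateral of isothermic surfaces in $\mathbb{R}^n$ on $(M,Q)$, let $r_3\in\mathbb{R}\setminus\{0\}$ and let $f'=\mathcal{D}_{r_3}f$ be a Darboux transform of $f$. Then there are Darboux transforms $f_1'=\mathcal{D}_{r_3}f_1$, $f_2'=\mathcal{D}_{r_3}f_2$ and $\hat f'=\mathcal{D}_{r_3}\hat f$ such that $(f',f_1',\hat f',f_2')$ is a Bianchi quadrilateral.
   Context: $C\ell_n$ is the real Clifford algebra of Euclidean $\mathbb{R}^n$, with $vw+wv=-2(v,w)1$ for $v,w\in\mathbb{R}^n$; nonzero vectors are invertible. For $C\ell_n$-valued 1-forms, $(\alpha\wedge\beta)(X,Y)=\alpha(X)\beta(Y)-\alpha(Y)\beta(X)$. A polarised Riemann surface $(M,Q)$ is a Riemann surface $M$ with a nonzero holomorphic quadratic differential $Q$. For $\mathbb{R}^n$-valued 1-forms, $(\alpha,\beta)^{2,0}=(\alpha(\partial_z),\beta(\partial_z))\,dz^2$. A conformal immersion $f:(M,Q)\to\mathbb{R}^n$ is isothermic if there is a map $f^c:M\to\mathbb{R}^n$ with $df\wedge df^c=0$ and $(df,df^c)^{2,0}=Q$; $f^c$ is unique up to translation and called the Christoffel transform of $f$. For $r\in\mathbb{R}\setminus\{0\}$, $\mathcal{D}_rf$ denotes any map $f+g$ where $g:M\to\mathbb{R}^n$ solves $dg=r\,g\,df^c\,g-df$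 (products in $C\ell_n$); different choices correspond to different initial conditions. A Darboux transform $f+g$ is isothermic on the same $(M,Q)$, with Christoffel transform $f^c+(rg)^{-1}$. Clifford algebra cross-ratio: $C(v_0,v_1,v_2,v_3)=(v_0-v_1)(v_1-v_2)^{-1}(v_2-v_3)(v_3-v_0)^{-1}\in C\ell_n$. A Bianchi quadrilateral is a quadruple $(f,f_1,\hat f,f_2)$ of isothermic surfaces on $(M,Q)$ such that, for some $r_1,r_2\in\mathbb{R}\setminus\{0\}$, $f_1=\mathcal{D}_{r_1}f$ and $f_2=\mathcal{D}_{r_2}f$ are distinct, $\hat f=\mathcal{D}_{r_2}f_1=\mathcal{D}_{r_1}f_2$, and corresponding points of the four surfaces are concircular with $C(f,f_1,\hat f,f_2)=r_2/r_1$. All maps are smooth, and statements are local: $M$ may be shrunk to an open simply connected set on which all maps involved exist, take finite values and are pointwise distinct where inverses of their differences occur (in particular $f'$ is pointwise distinct from $f,f_1,f_2$); transforms are immersions away from the zeros of $Q$.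
   Formalization: The case r1 = r2 = r3 is excluded, because there the claim can fail (e.g. n = 2, constant Q, f = f̂ = z, f1 = z + i, f2 = z − tan z, f' = z − i, all parameters equal); all other coincidences of parameters are kept. *)

(* Defs.v *)
From HB Require Import structures.
From mathcomp Require Import all_boot all_order all_algebra all_field.
From mathcomp Require Import all_classical all_reals all_analysis.
From mathcomp Require Import complex ring.

Set Implicit Arguments.
Unset Strict Implicit.
Unset Printing Implicit Defensive.

Import Order.TTheory GRing.Theory Num.Theory.
Import numFieldNormedType.Exports.

Local Open Scope ring_scope.

(* Basis e_A = e_(i1) ... e_(ik), for A = {i1 < ... < ik} a subset of 'I_n. *)
Definition clifford (R : fieldType) (n : nat) : Type :=
  {ffun {set 'I_n} -> R^o}.

Section Clifford.
Variables (R : fieldType) (n : nat).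
Implicit Types (A B C : {set 'I_n}) (x y z : clifford R n).

HB.instance Definition _ :=
  Vector.copy (clifford R n) {ffun {set 'I_n} -> R^o}.

Definition clifford_coef x A : R := (x : {ffun {set 'I_n} -> R^o}) A.

Definition symdiff A B : {set 'I_n} := (A :\: B) :|: (B :\: A).

(* e_A e_B = clifford_sign A B e_(symdiff A B): a pair i in A, j in B costs one
   transposition if j < i, and e_i ^ 2 = -1 accounts for the pairs i = j. *)
Definition clifford_sign A B : R :=
  (-1) ^+ (\sum_(i in A) \sum_(j in B) (j <= i)%N)%N.

Definition clifford_mul x y : clifford R n :=
  [ffun C => \sum_A \sum_(B | symdiff A B == C)
               clifford_sign A B * clifford_coef x A * clifford_coef y B].

Definition clifford_one : clifford R n :=
  [ffun A => if A == finset.set0 then 1 else 0].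

Lemma cliffordP x y : (forall A, clifford_coef x A = clifford_coef y A) -> x = y.
Proof. by move=> xy; apply/ffunP=> A; apply: xy. Qed.

Lemma clifford_coefD x y A : clifford_coef (x + y) A = clifford_coef x A + clifford_coef y A.
Proof. by rewrite /clifford_coef ffunE. Qed.

Lemma clifford_coefZ (c : R) x A : clifford_coef (c *: x) A = c * clifford_coef x A.
Proof. by rewrite /clifford_coef ffunE. Qed.

Lemma clifford_coef1 A : clifford_coef clifford_one A = (A == finset.set0)%:R.
Proof. by rewrite /clifford_coef ffunE; case: eqP. Qed.

Lemma in_symdiff A B i : (i \in symdiff A B) = (i \in A) (+) (i \in B).
Proof. by rewrite !inE; case: (i \in A); case: (i \in B). Qed.

Lemma symdiff0 A : symdiff A finset.set0 = A.
Proof. by apply/setP=> i; rewrite in_symdiff inE addbF. Qed.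

Lemma symdiffK A B : symdiff A (symdiff A B) = B.
Proof. by apply/setP=> i; rewrite !in_symdiff addKb. Qed.

Lemma symdiff_eq A B C : (symdiff A B == C) = (B == symdiff A C).
Proof. by apply/eqP/eqP=> [<-|->]; rewrite symdiffK. Qed.

Lemma symdiff_eq0 A B : (symdiff A B == finset.set0) = (A == B).
Proof. by rewrite symdiff_eq symdiff0 eq_sym. Qed.

Lemma clifford_coefM x y C : clifford_coef (clifford_mul x y) C =
  \sum_A clifford_sign A (symdiff A C) * clifford_coef x A * clifford_coef y (symdiff A C).
Proof.
rewrite {1}/clifford_coef ffunE; apply: eq_bigr => A _.
under eq_bigl do rewrite symdiff_eq.
by rewrite big_pred1_eq.
Qed.

Lemma clifford_signE A B : clifford_sign A B =
  \prod_(i < n) \prod_(j < n) (-1) ^+ [&& (j <= i)%N, i \in A & j \in B].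
Proof.
rewrite /clifford_sign -prodrXr big_mkcond /=; apply: eq_bigr => i _.
case: ifP => iA; last by rewrite big1 // => j _; rewrite andbF.
rewrite -prodrXr big_mkcond; apply: eq_bigr => j _.
by case: (j \in B); rewrite ?andbT ?andbF.
Qed.

Lemma clifford_signDl A B C :
  clifford_sign (symdiff A B) C = clifford_sign A C * clifford_sign B C.
Proof.
rewrite !clifford_signE -big_split; apply: eq_bigr => i _ /=.
rewrite -big_split; apply: eq_bigr => j _ /=.
rewrite in_symdiff -signr_addb.
by case: (_ <= _)%N; case: (i \in A); case: (i \in B); case: (j \in C).
Qed.

Lemma clifford_signDr A B C :
  clifford_sign A (symdiff B C) = clifford_sign A B * clifford_sign A C.
Proof.
rewrite !clifford_signE -big_split; apply: eq_bigr => i _ /=.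
rewrite -big_split; apply: eq_bigr => j _ /=.
rewrite in_symdiff -signr_addb.
by case: (_ <= _)%N; case: (i \in A); case: (j \in B); case: (j \in C).
Qed.

Lemma clifford_sign0l A : clifford_sign finset.set0 A = 1.
Proof. by rewrite /clifford_sign big_set0. Qed.

Lemma clifford_sign0r A : clifford_sign A finset.set0 = 1.
Proof. by rewrite /clifford_sign big1 // => i _; rewrite big_set0. Qed.

Lemma clifford_sign_sqr A B : clifford_sign A B * clifford_sign A B = 1.
Proof. by rewrite -expr2 sqrr_sign. Qed.

Lemma clifford_mulA : associative clifford_mul.
Proof.
move=> x y z; apply: cliffordP => D; rewrite !clifford_coefM.
under eq_bigr => A _ do rewrite clifford_coefM mulr_sumr.
under [RHS]eq_bigr => C _ do rewrite clifford_coefM mulr_sumr mulr_suml.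
rewrite [RHS]exchange_big; apply: eq_bigr => A _ /=.
rewrite [RHS](reindex_inj (can_inj (symdiffK A))) /=; apply: eq_bigr => C _.
have -> : symdiff (symdiff A C) D = symdiff C (symdiff A D).
  by apply/setP=> i; rewrite !in_symdiff addbA [(i \in C) (+) _]addbC.
rewrite symdiffK !clifford_signDr !clifford_signDl.
by rewrite -[LHS]mul1r -(clifford_sign_sqr A C); ring.
Qed.

Lemma clifford_mul1l : left_id clifford_one clifford_mul.
Proof.
move=> x; apply: cliffordP => C; rewrite clifford_coefM (bigD1 finset.set0) //=.
rewrite clifford_coef1 eqxx clifford_sign0l !mul1r big1 => [|A /negPf A0]; last first.
  by rewrite clifford_coef1 A0 mulr0 mul0r.
by rewrite addr0; congr clifford_coef; apply/setP=> i; rewrite in_symdiff inE.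
Qed.

Lemma clifford_mul1r : right_id clifford_one clifford_mul.
Proof.
move=> x; apply: cliffordP => C; rewrite clifford_coefM (bigD1 C) //=.
rewrite clifford_coef1 symdiff_eq0 eqxx mulr1.
have -> : symdiff C C = finset.set0 by apply/eqP; rewrite symdiff_eq0.
rewrite clifford_sign0r mul1r big1 ?addr0 // => A /negPf AC.
by rewrite clifford_coef1 symdiff_eq0 AC mulr0.
Qed.

Lemma clifford_mulDl : left_distributive clifford_mul +%R.
Proof.
move=> x y z; apply: cliffordP => C; rewrite clifford_coefD !clifford_coefM -big_split.
by apply: eq_bigr => A _; rewrite clifford_coefD mulrDr mulrDl.
Qed.

Lemma clifford_mulDr : right_distributive clifford_mul +%R.
Proof.
move=> x y z; apply: cliffordP => C; rewrite clifford_coefD !clifford_coefM -big_split.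
by apply: eq_bigr => A _; rewrite clifford_coefD mulrDr.
Qed.

Lemma clifford_one_neq0 : clifford_one != 0.
Proof.
apply/eqP=> /(congr1 (clifford_coef^~ finset.set0)) /eqP.
by rewrite clifford_coef1 eqxx /clifford_coef ffunE oner_eq0.
Qed.

HB.instance Definition _ := GRing.Zmodule_isNzRing.Build (clifford R n)
  clifford_mulA clifford_mul1l clifford_mul1r clifford_mulDl clifford_mulDr
  clifford_one_neq0.

Lemma clifford_scaleAl (c : R) x y : c *: (x * y) = (c *: x) * y.
Proof.
apply: cliffordP => C; rewrite clifford_coefZ !clifford_coefM mulr_sumr.
by apply: eq_bigr => A _; rewrite clifford_coefZ; ring.
Qed.

Lemma clifford_scaleAr (c : R) x y : c *: (x * y) = x * (c *: y).
Proof.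
apply: cliffordP => C; rewrite clifford_coefZ !clifford_coefM mulr_sumr.
by apply: eq_bigr => A _; rewrite clifford_coefZ mulrCA.
Qed.

HB.instance Definition _ :=
  GRing.Lmodule_isLalgebra.Build R (clifford R n) clifford_scaleAl.
HB.instance Definition _ :=
  GRing.Lalgebra_isAlgebra.Build R (clifford R n) clifford_scaleAr.
HB.instance Definition _ := Algebra_isFalgebra.Build R (clifford R n).

Definition clifford_basis A : clifford R n :=
  [ffun B => if B == A then 1 else 0].

(* The inclusion of R^n in the Clifford algebra. *)
Definition cvec (v : 'rV[R]_n) : clifford R n :=
  \sum_(i < n) v 0 i *: clifford_basis [set i].

Definition dot (v w : 'rV[R]_n) : R := \sum_(i < n) v 0 i * w 0 i.

Lemma clifford_coef_basis A B : clifford_coef (clifford_basis A) B = (B == A)%:R.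
Proof. by rewrite /clifford_coef ffunE; case: eqP. Qed.

Lemma clifford_basisM A B : clifford_basis A * clifford_basis B =
  clifford_sign A B *: clifford_basis (symdiff A B).
Proof.
apply: cliffordP => C; rewrite clifford_coefZ clifford_coefM (bigD1 A) //= !clifford_coef_basis eqxx.
rewrite mulr1 big1 ?addr0 => [|A' /negPf A'A]; last first.
  by rewrite clifford_coef_basis A'A mulr0 mul0r.
rewrite symdiff_eq; case: eqP => [->|_]; last by rewrite !mulr0.
by rewrite symdiffK.
Qed.

Lemma cvec_is_linear : linear cvec.
Proof.
move=> a v w; rewrite /cvec scaler_sumr -big_split; apply: eq_bigr => i _ /=.
by rewrite !mxE scalerDl scalerA.
Qed.

HB.instance Definition _ :=
  GRing.isLinear.Build R 'rV[R]_n (clifford R n) *:%R cvec cvec_is_linear.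

Lemma clifford_basisC i j :
  clifford_basis [set i] * clifford_basis [set j] +
  clifford_basis [set j] * clifford_basis [set i] = ((i == j)%:R *- 2) *: 1.
Proof.
have s (k l : 'I_n) : clifford_sign [set k] [set l] = (-1) ^+ (l <= k)%N.
  by rewrite /clifford_sign !big_set1.
rewrite !clifford_basisM !s.
have -> : symdiff [set j] [set i] = symdiff [set i] [set j].
  by apply/setP=> k; rewrite !in_symdiff addbC.
rewrite -scalerDl; have [<-|ij] := eqVneq i j.
  rewrite leqnn -opprD; congr (_ *: _); apply: cliffordP => A.
  rewrite clifford_coef_basis clifford_coef1; congr (_ == _)%:R.
  by apply/eqP; rewrite symdiff_eq0.
rewrite mul0rn oppr0 scale0r.
case: (ltngtP i j) ij => // [_ _|_ _|/val_inj ->]; last by rewrite eqxx.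
  by rewrite expr0 expr1 subrr scale0r.
by rewrite expr0 expr1 addNr scale0r.
Qed.

(* The defining relation v w + w v = -2 (v, w) 1. *)
Lemma cvecC v w : cvec v * cvec w + cvec w * cvec v = (dot v w *- 2) *: 1.
Proof.
rewrite /cvec !mulr_suml.
under eq_bigr => i _ do rewrite mulr_sumr.
under [X in _ + X]eq_bigr => i _ do rewrite mulr_sumr.
rewrite [X in _ + X]exchange_big -big_split /=.
rewrite /dot -mulNrn -sumrN -sumrMnl scaler_suml; apply: eq_bigr => i _.
rewrite -big_split /= (bigD1 i) //= big1 => [|j /negPf ij].
  rewrite addr0 -!scalerAl -!scalerAr !scalerA mulrC -scalerDr clifford_basisC.
  by rewrite eqxx scalerA mulrN mulr_natr mulrC mulNrn.
rewrite -!scalerAl -!scalerAr !scalerA [w 0 j * _]mulrC -scalerDr.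
by rewrite clifford_basisC eq_sym ij mul0rn oppr0 scale0r scaler0.
Qed.

End Clifford.

Local Open Scope classical_set_scope.
Local Open Scope complex_scope.

(* A simply connected polarised Riemann surface is covered by one chart
   z = x + i y: it is not the sphere, which has no nonzero holomorphic
   quadratic differential, so it is an open subset M of the plane by
   uniformisation, with a quadratic differential Q dz^2.  A point of the plane
   is the pair (x, y). *)
Section Surfaces.
Variables (R : realType) (n : nat).
Local Notation plane := (R * R)%type.
Local Notation vec := 'rV[R]_n.
Implicit Types (M U : set plane) (Q : plane -> R[i]) (f g : plane -> vec).

Definition loop_in M (c : R -> plane) : Prop :=
  [/\ {within `[0, 1], continuous c}, c 0 = c 1 &
      forall t, 0 <= t <= 1 -> M (c t)].

Definition simply_connected M : Prop :=
  [/\ M !=set0,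
      forall z w, M z -> M w -> exists c : R -> plane,
        [/\ {within `[0, 1], continuous c}, c 0 = z, c 1 = w &
            forall t, 0 <= t <= 1 -> M (c t)] &
      forall c : R -> plane, loop_in M c -> exists H : R * R -> plane,
        [/\ {within `[0, 1] `*` `[0, 1], continuous H},
            forall t, 0 <= t <= 1 -> H (0, t) = c t,
            forall t, 0 <= t <= 1 -> H (1, t) = c 0,
            forall s, 0 <= s <= 1 -> H (s, 0) = c 0 /\ H (s, 1) = c 0 &
            forall s t, 0 <= s <= 1 -> 0 <= t <= 1 -> M (H (s, t))]].

(* Complex differentiability, over the field R[i]. *)
Definition holomorphic M Q : Prop :=
  forall z, M z ->
    derivable (fun w : (R[i])^o => Q (complex.Re w, complex.Im w) : (R[i])^o) (z.1 +i* z.2) 1.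

Record polarised M Q : Prop := Polarised {
  polarised_open : open M;
  polarised_sc : simply_connected M;
  polarised_hol : holomorphic M Q;
  polarised_neq0 : exists2 z, M z & Q z != 0 }.

Fixpoint Ck (k : nat) M f : Prop :=
  match k with
  | 0 => forall z, M z -> {for z, continuous f}
  | k'.+1 => (forall z, M z -> differentiable f z) /\
             (forall X : plane, Ck k' M (fun z => 'D_X f z))
  end.

Definition smooth M f : Prop := forall k, Ck k M f.

Definition form : Type := plane -> plane -> vec.

Definition dform f : form := fun z X => 'D_X f z.

Definition clifford_wedge (alpha beta : form) (z X Y : plane) : clifford R n :=
  cvec (alpha z X) * cvec (beta z Y) - cvec (alpha z Y) * cvec (beta z X).

(* alpha(d/dz), with d/dz = (d/dx - i d/dy) / 2. *)
Definition form_dz (alpha : form) (z : plane) : 'rV[R[i]]_n :=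
  \row_j ((alpha z (1, 0) 0 j +i* (- alpha z (0, 1) 0 j)) / 2).

(* The coefficient of dz^2; dot over R[i] is the complex bilinear extension of
   the inner product. *)
Definition form20 (alpha beta : form) (z : plane) : R[i] :=
  dot (form_dz alpha z) (form_dz beta z).

Definition christoffel M Q f fc : Prop :=
  [/\ smooth M fc,
      forall z X Y, M z -> clifford_wedge (dform f) (dform fc) z X Y = 0 &
      forall z, M z -> form20 (dform f) (dform fc) z = Q z].

Definition conformal_at f (z : plane) : Prop :=
  exists2 lambda : R, 0 <= lambda &
    forall X Y : plane,
      dot (dform f z X) (dform f z Y) = lambda * (X.1 * Y.1 + X.2 * Y.2).

Definition immersion_at f (z : plane) : Prop :=
  forall X : plane, dform f z X = 0 -> X = 0.

(* Darboux transforms are immersions only away from the zeros of Q, so that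
   immersivity is not required at those zeros.  Where Q has no zero this is the
   notion of an isothermic conformal immersion. *)
Definition isothermic M Q f : Prop :=
  [/\ smooth M f,
      forall z, M z -> conformal_at f z,
      forall z, M z -> Q z != 0 -> immersion_at f z &
      exists fc, christoffel M Q f fc].

Definition darboux M Q (r : R) f f' : Prop :=
  exists fc g,
    [/\ christoffel M Q f fc,
        smooth M g,
        forall z X, M z ->
          cvec (dform g z X) =
          r *: (cvec (g z) * cvec (dform fc z X) * cvec (g z)) - cvec (dform f z X) &
        forall z, M z -> f' z = f z + g z].

(* clifford is an falgType: ^-1 is the inverse in the algebra, and the identity
   on non-units, such as cvec 0.  bianchi_with makes the four differences
   nonzero. *)
Definition cross_ratio (v0 v1 v2 v3 : vec) : clifford R n :=
  cvec (v0 - v1) * (cvec (v1 - v2))^-1 * cvec (v2 - v3) * (cvec (v3 - v0))^-1.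

Definition is_line (L : set vec) : Prop :=
  exists p u : vec, u != 0 /\ L = [set p + t *: u | t in [set: R]].

Definition is_circle (S : set vec) : Prop :=
  exists (p a b : vec) (rho : R),
    [/\ 0 < rho, dot a a = 1, dot b b = 1, dot a b = 0 &
        S = [set p + rho *: (t.1 *: a + t.2 *: b) | t in
              [set t : plane | t.1 ^+ 2 + t.2 ^+ 2 = 1]]].

(* Circles are circles of the conformal sphere, thus lines are included. *)
Definition concircular (v0 v1 v2 v3 : vec) : Prop :=
  exists S, (is_circle S \/ is_line S) /\ [/\ S v0, S v1, S v2 & S v3].

Definition bianchi_with M Q (r1 r2 : R) f f1 fh f2 : Prop :=
  [/\ r1 != 0 /\ r2 != 0,
      [/\ isothermic M Q f, isothermic M Q f1, isothermic M Q fh &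
          isothermic M Q f2],
      [/\ darboux M Q r1 f f1, darboux M Q r2 f f2, darboux M Q r2 f1 fh &
          darboux M Q r1 f2 fh],
      forall z, M z ->
        [/\ f z != f1 z, f z != f2 z, f1 z != f2 z, f1 z != fh z &
            f2 z != fh z] &
      forall z, M z ->
        concircular (f z) (f1 z) (fh z) (f2 z) /\
        cross_ratio (f z) (f1 z) (fh z) (f2 z) = (r2 / r1) *: 1].

Definition bianchi M Q f f1 fh f2 : Prop :=
  exists r1 r2, bianchi_with M Q r1 r2 f f1 fh f2.

End Surfaces.

(* Main.v *)
From HB Require Import structures.
Require Import Defs.
From mathcomp Require Import all_boot all_order all_algebra.
From mathcomp Require Import all_classical all_reals all_analysis.
From mathcomp Require Import complex ring lra.

Import Order.TTheory GRing.Theory Num.Theory.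
Import numFieldNormedType.Exports.

Set Implicit Arguments.
Unset Strict Implicit.
Unset Printing Implicit Defensive.

(** Let u_i be the Clifford inverse of f_i - f, that is, put f at infinity.  The
    fourth vertex of a Bianchi quadrilateral becomes the affine combination
    u_ij = (r_i u_j - r_j u_i) / (r_i - r_j), or infinity when r_i = r_j, and the
    Riccati equation becomes du_i = u_i df u_i - r_i df^c, so df^c cancels in
    d(r_i u_j - r_j u_i).  This gives Bianchi permutability: the fourth vertex of
    (f, f_i, f_j) is a Darboux transform of f_i and of f_j.  Let f_1', f_2' be the
    fourth vertices of (f, f_1, f') and (f, f_2, f').  The fourth vertices of
    (f_1, fh, f_1') and of (f', f_1', f_2') agree because changing the base point
    of an inversion is again affine up to inversions (three-dimensional
    consistency).  The degenerate configurations are given by linear relations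
    between the u_i with constant coefficients; differentiating such a relation
    shows that it cannot hold on an open set, so all of them are avoided by
    shrinking the domain. *)

Local Open Scope ring_scope.

(** * Inversion in the Clifford algebra *)

(** Apart from the given [f'], no Riccati equation is solved: every new surface is the algebraic
    expression [vertex], and this is how the initial conditions get chosen. The sandwich u x u of
    vectors is again a vector, so most identities can be checked in R^n with commuting scalars;
    Clifford products serve mainly to cancel factors. The Christoffel transform is only given by
    existence, and its differential is determined by df and Q where Q has no zero; hence the
    restriction to such points. A relation between the u_i with constant coefficients, chosen so
    that the terms r_i df^c cancel, differentiates to the same relation between the u_i df u_i. The
    first is linear and the second quadratic in the u_i. For three transforms, elimination leaves a
    multiple of (u_i - u_j) df (u_i - u_j), which does not vanish because f is immersed and u_i
    differs from u_j. If r_1 = r_2 = r_3, all these fourth vertices collapse to the base point, f_1'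
    and f_2' coincide with f, and the construction gives no quadrilateral; [hr] excludes this. *)

Section UnitRing.
Variable A : unitRingType.
Implicit Types u p q : A.

(** Both orders of the factors are needed, here and in [subrV_units_sym]: sandwiches cancel on the
    left with one and on the right with the other. *)
Lemma subrV_units u p : u \is a GRing.unit -> p \is a GRing.unit ->
  p^-1 - u^-1 = - (u^-1 * (p - u) * p^-1).
Proof.
by move=> Uu Up; rewrite mulrBr mulVr // mulrBl mul1r mulrK // opprB.
Qed.

Lemma subrV_units_sym u p : u \is a GRing.unit -> p \is a GRing.unit ->
  p^-1 - u^-1 = - (p^-1 * (p - u) * u^-1).
Proof.
by move=> Uu Up; rewrite mulrBr mulVr // mulrBl mul1r mulrK // opprB.
Qed.

Lemma invrB_invr u p : u \is a GRing.unit -> p \is a GRing.unit ->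
  p - u \is a GRing.unit ->
  (p^-1 - u^-1)^-1 = - u - u * (p - u)^-1 * u.
Proof.
move=> Uu Up Upu; have Uupu : u^-1 * (p - u) \is a GRing.unit.
  by rewrite unitrMr ?unitrV.
rewrite subrV_units // invrN !invrM ?unitrV // !invrK.
by rewrite -{1}[p](subrK u) mulrDl mulrA divrr // mul1r opprD mulrA.
Qed.

Lemma mulrV_invrB_invr u p : u \is a GRing.unit -> p \is a GRing.unit ->
  p - u \is a GRing.unit ->
  (p^-1 - u^-1)^-1 * u^-1 * (p - u) = - p.
Proof.
move=> Uu Up Upu; have Uupu : p^-1 * (p - u) \is a GRing.unit.
  by rewrite unitrMr ?unitrV.
rewrite subrV_units // invrN; have Uupu' : u^-1 * (p - u) \is a GRing.unit.
  by rewrite unitrMr ?unitrV.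
rewrite invrM ?unitrV // invrK [(u^-1 * _)^-1]invrM ?unitrV // invrK.
by rewrite !mulNr !mulrA mulrK // mulrVK.
Qed.

Lemma mul_mulrV_invrB_invr u p : u \is a GRing.unit -> p \is a GRing.unit ->
  p - u \is a GRing.unit ->
  (p - u) * u^-1 * (p^-1 - u^-1)^-1 = - p.
Proof.
move=> Uu Up Upu; have Uupu : p^-1 * (p - u) \is a GRing.unit.
  by rewrite unitrMr ?unitrV.
rewrite subrV_units_sym // invrN invrM ?unitrV // invrK invrM ?unitrV // invrK.
by rewrite mulrN -!mulrA mulKr // mulVKr.
Qed.

(** [k] is both - p (p - u)^-1 u and - u (p - u)^-1 p, so on either side it strips off [u^-1] and
    [p - u] and leaves [- p]. *)
Lemma conj_invrB_invr u p x : u \is a GRing.unit -> p \is a GRing.unit ->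
  p - u \is a GRing.unit ->
  let k := (p^-1 - u^-1)^-1 in
  k * (u^-1 * ((p - u) * x * (p - u)) * u^-1) * k = p * x * p.
Proof.
move=> Uu Up Upu k; rewrite !mulrA mulrV_invrB_invr // -[LHS]mulrA -[LHS]mulrA.
rewrite [(p - u) * _]mulrA mul_mulrV_invrB_invr //.
by rewrite mulrN !mulNr opprK.
Qed.

(** Write v^-1 - v_i^-1 = - v^-1 (v - v_i) v_i^-1; the factors [v] meet in the middle and cancel.
    The left-hand side is a cross-ratio with one point at the origin. *)
Lemma invrB_mulrB (v v1 v2 : A) : v \is a GRing.unit -> v1 \is a GRing.unit ->
  v2 \is a GRing.unit -> v - v1 \is a GRing.unit ->
  v1 * (v - v1)^-1 * (v - v2) * v2^-1 =
  (v^-1 - v1^-1)^-1 * (v^-1 - v2^-1).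
Proof.
move=> Uv Uv1 Uv2 Uvv1; have Uvv1' : v^-1 * (v - v1) \is a GRing.unit.
  by rewrite unitrMr ?unitrV.
rewrite (subrV_units_sym Uv1 Uv) (subrV_units_sym Uv2 Uv) invrN.
rewrite invrM ?unitrV // invrK invrM ?unitrV // invrK.
by rewrite mulNr mulrN opprK !mulrA mulrK.
Qed.

End UnitRing.

(** The Clifford inverse as a vector, from v v = - (v, v). It sends 0 to 0, as does the inverse of
    the algebra, so [cvec_vinv] holds for every vector. The lock makes it an atom for coordinate
    computations. *)
HB.lock Definition vinv (R : realFieldType) n (v : 'rV[R]_n) : 'rV[R]_n :=
  (- (dot v v)^-1) *: v.
Arguments vinv {R n} v.

(* The Clifford product [u x u] of vectors. *)
HB.lock Definition tri (R : realFieldType) n (u x : 'rV[R]_n) : 'rV[R]_n :=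
  dot u u *: x - (2 * dot u x) *: u.
Arguments tri {R n} u x.

(** * Vectors inside the Clifford algebra: inner product, inverse and sandwich *)

Section Vectors.
Variables (R : realFieldType) (n : nat).
Implicit Types (u v w x y : 'rV[R]_n) (a b c : R).

Lemma dotC v w : dot v w = dot w v.
Proof. by apply: eq_bigr => i _; rewrite mulrC. Qed.

Lemma dotDl u v w : dot (u + v) w = dot u w + dot v w.
Proof. by rewrite /dot -big_split; apply: eq_bigr => i _; rewrite mxE mulrDl. Qed.

Lemma dotDr u v w : dot w (u + v) = dot w u + dot w v.
Proof. by rewrite dotC dotDl ![dot _ w]dotC. Qed.

Lemma dotZl c v w : dot (c *: v) w = c * dot v w.
Proof. by rewrite /dot mulr_sumr; apply: eq_bigr => i _; rewrite mxE mulrA. Qed.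

Lemma dotZr c v w : dot w (c *: v) = c * dot w v.
Proof. by rewrite dotC dotZl dotC. Qed.

Lemma dotNl v w : dot (- v) w = - dot v w.
Proof. by rewrite -scaleN1r dotZl mulN1r. Qed.

Lemma dotNr v w : dot w (- v) = - dot w v.
Proof. by rewrite dotC dotNl dotC. Qed.

Lemma dot0l v : dot 0 v = 0.
Proof. by rewrite -(scale0r v) dotZl mul0r. Qed.

Definition dotE := (dotDl, dotDr, dotNl, dotNr, dotZl, dotZr).

Lemma dot_ge0 v : 0 <= dot v v.
Proof. by apply: sumr_ge0 => i _; rewrite -expr2 sqr_ge0. Qed.

Lemma dot_eq0 v : (dot v v == 0) = (v == 0).
Proof.
apply/idP/eqP => [|->]; last by rewrite dot0l.
rewrite /dot psumr_eq0 => [/allP v0|i _]; last by rewrite -expr2 sqr_ge0.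
apply/rowP => i; rewrite mxE; apply/eqP.
by have := v0 i (mem_index_enum i); rewrite /= mulf_eq0 orbb.
Qed.

Lemma dot_gt0 v : v != 0 -> 0 < dot v v.
Proof. by move=> v0; rewrite lt_def dot_ge0 dot_eq0 v0. Qed.

Lemma cvec_coef v i : clifford_coef (cvec v) [set i] = v 0 i.
Proof.
rewrite /cvec /clifford_coef sum_ffunE (bigD1 i) //= big1 => [|j /negPf ji].
  by rewrite !ffunE eqxx addr0 /GRing.scale /= mulr1.
by rewrite !ffunE (inj_eq set1_inj) eq_sym ji /GRing.scale /= mulr0.
Qed.

Lemma cvec_inj : injective (@cvec R n).
Proof. by move=> v w vw; apply/rowP => i; rewrite -!cvec_coef vw. Qed.

Lemma cvecD v w : cvec (v + w) = cvec v + cvec w.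
Proof. exact: linearD. Qed.

Lemma cvecN v : cvec (- v) = - cvec v.
Proof. exact: linearN. Qed.

Lemma cvecZ c v : cvec (c *: v) = c *: cvec v.
Proof. exact: linearZ. Qed.

Lemma cvecM_anti v w : cvec w * cvec v = - (cvec v * cvec w) - (2 * dot v w) *: 1.
Proof.
by rewrite mulr_natl -scaleNr -cvecC addKr.
Qed.

Lemma cvec_sqr v : cvec v * cvec v = (- dot v v) *: 1.
Proof.
have := cvecC v v; rewrite -mulr2n -mulNrn -scalerMnl.
rewrite -[LHS]scaler_nat -[RHS]scaler_nat => vv; have two : (2 : R) != 0 by rewrite pnatr_eq0.
exact: (scalerI two vv).
Qed.

Lemma cvec_tri u x : cvec (tri u x) = cvec u * cvec x * cvec u.
Proof.
rewrite -mulrA cvecM_anti mulrBr mulrN mulrA cvec_sqr -scalerAl mul1r scaleNr opprK.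
by rewrite -scalerAr mulr1 tri.unlock linearB !linearZ.
Qed.

Lemma cvec_vinvM v : v != 0 -> cvec (vinv v) * cvec v = 1.
Proof.
rewrite -dot_eq0 => v0.
by rewrite vinv.unlock linearZ -scalerAl cvec_sqr scalerA mulrNN mulVf // scale1r.
Qed.

Lemma cvec_mulvinv v : v != 0 -> cvec v * cvec (vinv v) = 1.
Proof.
rewrite -dot_eq0 => v0.
by rewrite vinv.unlock linearZ -scalerAr cvec_sqr scalerA mulrNN mulVf // scale1r.
Qed.

Lemma cvec_unit v : v != 0 -> cvec v \is a GRing.unit.
Proof.
move=> v0; apply/unitrP; exists (cvec (vinv v)).
by rewrite cvec_vinvM // cvec_mulvinv.
Qed.

Lemma vinv0 : vinv (0 : 'rV[R]_n) = 0.
Proof. by rewrite vinv.unlock scaler0. Qed.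

Lemma cvec_vinv v : cvec (vinv v) = (cvec v)^-1.
Proof.
have [->|v0] := eqVneq v 0; first by rewrite vinv0 linear0 invr0.
by apply: (mulrI (cvec_unit v0)); rewrite cvec_mulvinv // divrr // cvec_unit.
Qed.

Lemma vinvK : involutive (@vinv R n).
Proof. by move=> v; apply: cvec_inj; rewrite !cvec_vinv invrK. Qed.

Lemma vinv_inj : injective (@vinv R n).
Proof. exact: can_inj vinvK. Qed.

Lemma vinv_eq0 v : (vinv v == 0) = (v == 0).
Proof.
by apply/eqP/eqP => [v0|->]; [rewrite -(vinvK v) v0|]; rewrite vinv0.
Qed.

Lemma vinvZ c v : vinv (c *: v) = c^-1 *: vinv v.
Proof.
rewrite vinv.unlock !dotE !scalerA; have [->|c0] := eqVneq c 0.
  by rewrite invr0 !(mul0r, mulr0, scale0r).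
by congr (_ *: _); rewrite !invfM; move: (dot v v)^-1 => e; field.
Qed.

Lemma vinvN v : vinv (- v) = - vinv v.
Proof. by rewrite -scaleN1r vinvZ invrN1 scaleN1r. Qed.

Lemma triDr u x y : tri u (x + y) = tri u x + tri u y.
Proof. by apply: cvec_inj; rewrite cvec_tri [RHS]linearD /= !cvec_tri linearD mulrDr mulrDl. Qed.

Lemma triZr u c x : tri u (c *: x) = c *: tri u x.
Proof.
by apply: cvec_inj; rewrite cvec_tri [RHS]linearZ /= cvec_tri linearZ -scalerAr -scalerAl.
Qed.

Lemma triNr u x : tri u (- x) = - tri u x.
Proof. by rewrite -scaleN1r triZr scaleN1r. Qed.

Lemma triBr u x y : tri u (x - y) = tri u x - tri u y.
Proof. by rewrite triDr triNr. Qed.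

Lemma tri0r u : tri u 0 = 0.
Proof. by rewrite -(scale0r u) triZr !scale0r. Qed.

Lemma triZl c u x : tri (c *: u) x = (c * c) *: tri u x.
Proof.
apply: cvec_inj; rewrite cvec_tri [RHS]linearZ /= cvec_tri linearZ.
by rewrite -!scalerAl -!scalerAr !scalerA.
Qed.

Lemma triNl u x : tri (- u) x = tri u x.
Proof. by rewrite -scaleN1r triZl mulrNN mulr1 scale1r. Qed.

Lemma vinv_tri u x : u != 0 -> vinv (tri u x) = tri (vinv u) (vinv x).
Proof.
move=> u0; have [->|x0] := eqVneq x 0.
  by rewrite vinv0 !tri0r vinv0.
apply: cvec_inj; rewrite !(cvec_tri, cvec_vinv) !invrM ?unitrMr ?cvec_unit //.
by rewrite mulrA.
Qed.

Lemma tri_vinvK u x : u != 0 -> tri u (tri (vinv u) x) = x.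
Proof.
move=> u0; have Uu := cvec_unit u0; apply: cvec_inj.
by rewrite !(cvec_tri, cvec_vinv) !mulrA divrr // mul1r mulrVK.
Qed.

Lemma trivK u x : u != 0 -> tri (vinv u) (tri u x) = x.
Proof. by move=> u0; rewrite -[X in tri _ (tri X _)]vinvK tri_vinvK // vinv_eq0. Qed.

Lemma tri_eq0 u x : u != 0 -> (tri u x == 0) = (x == 0).
Proof.
move=> u0; apply/eqP/eqP => [t0|->].
  by rewrite -(trivK x u0) t0 tri0r.
by rewrite tri0r.
Qed.

Lemma tri_vinv u : tri u (vinv u) = u.
Proof.
have [->|u0] := eqVneq u 0.
  by rewrite vinv0 tri0r.
by apply: cvec_inj; rewrite cvec_tri cvec_vinv divrr ?mul1r // cvec_unit.
Qed.

(** [tri u] is [dot u u] times the reflection in the hyperplane orthogonal to [u], hence a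
    similarity. *)
Lemma dot_tri u x y : dot (tri u x) (tri u y) = (dot u u) ^+ 2 * dot x y.
Proof.
by rewrite tri.unlock !dotE (dotC x u); ring.
Qed.

Lemma dot_tri_vinv u x y : u != 0 -> dot (tri u x) (tri (vinv u) y) = dot x y.
Proof.
rewrite -dot_eq0 => u0.
by rewrite vinv.unlock triZl dotZr dot_tri; field.
Qed.

(* Change of base point: the conjugate of a translation by the inversion. *)
Lemma vinvB_vinv u p : u != 0 -> p != 0 -> p != u ->
  vinv (vinv p - vinv u) = - u - tri u (vinv (p - u)).
Proof.
move=> u0 p0 pu; have pu0 : p - u != 0 by rewrite subr_eq0.
have Upu := cvec_unit pu0.
apply: cvec_inj; rewrite cvec_vinv !(cvecD, cvecN) cvec_tri !cvec_vinv.
by rewrite !(cvecD, cvecN) in Upu *; rewrite invrB_invr ?cvec_unit.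
Qed.

Lemma tri_vinvB_vinv u p x : u != 0 -> p != 0 -> p != u ->
  tri (vinv (vinv p - vinv u)) (tri (vinv u) (tri (p - u) x)) = tri p x.
Proof.
move=> u0 p0 pu; have pu0 : p - u != 0 by rewrite subr_eq0.
have Uu := cvec_unit u0; have Up := cvec_unit p0; have Upu := cvec_unit pu0.
rewrite cvecD cvecN in Upu.
apply: cvec_inj; rewrite !cvec_tri !(cvec_vinv, cvecD, cvecN).
have := conj_invrB_invr (cvec x) Uu Up Upu.
by [].
Qed.

End Vectors.

(** * The fourth vertex *)

Section Vertex.
Variables (R : realFieldType) (n : nat).
Implicit Types (u v w x y f : 'rV[R]_n) (a b c : R).

(* In the coordinates inverted at [f] this is [(a ub - b ua) / (a - b)]; the form
   below also covers [a = b], where the vertex is [f] itself. *)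
Definition vertex a b f fa fb : 'rV[R]_n :=
  f + (a - b) *: vinv (a *: vinv (fb - f) - b *: vinv (fa - f)).

(** For [a != b] the last condition keeps the fourth vertex finite: with [f] at infinity, coordinate
    0 is the point at infinity. Since [vinv 0 = 0], [vertex] would silently return [f] there. *)
Definition generic_corner a b f fa fb :=
  [/\ fa != f, fb != f, fa != fb & a *: vinv (fb - f) != b *: vinv (fa - f)].

Lemma generic_cornerC a b f fa fb :
  generic_corner a b f fa fb -> generic_corner b a f fb fa.
Proof. by case=> *; split=> //; rewrite eq_sym. Qed.

Lemma vertexC a b f fa fb : vertex a b f fa fb = vertex b a f fb fa.
Proof.
rewrite /vertex -[in RHS](opprB a b) -[b *: _ - _]opprB vinvN scalerN scaleNr.
by rewrite opprK.
Qed.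

Lemma vertex_diag a f fa fb : vertex a a f fa fb = f.
Proof. by rewrite /vertex subrr scale0r addr0. Qed.

Lemma vinv_vertexB a b f fa fb : a != b ->
  vinv (vertex a b f fa fb - f) =
  (a - b)^-1 *: (a *: vinv (fb - f) - b *: vinv (fa - f)).
Proof. by rewrite /vertex addrC addrA addNr add0r vinvZ vinvK. Qed.

(** Seen from [f], the vertex minus [u] is a / (a - b) times the difference for [fb]. The change of
    base point inverts this scalar, and the result (a - b) / a makes sense for a = b too. *)
Lemma vinv_vertexB_corner a b f fa fb : a != 0 -> generic_corner a b f fa fb ->
  let u := vinv (fa - f) in
  vinv (vertex a b f fa fb - fa) =
  - u - ((a - b) / a) *: tri u (vinv (vinv (fb - f) - u)).
Proof.
move=> a0 [fa0 fb0 fab X0] u.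
have [<-|ab] := eqVneq a b.
  by rewrite vertex_diag subrr mul0r scale0r subr0 -vinvN opprB.
have ab0 : a - b != 0 by rewrite subr_eq0.
have u0 : u != 0 by rewrite vinv_eq0 subr_eq0.
have uab : vinv (fb - f) - u != 0.
  by rewrite subr_eq0 (inj_eq (@vinv_inj _ _)) (inj_eq (addIr _)) eq_sym.
set p := vinv (vertex a b f fa fb - f).
have pE : p = (a - b)^-1 *: (a *: vinv (fb - f) - b *: u) by apply: vinv_vertexB.
have puE : p - u = (a / (a - b)) *: (vinv (fb - f) - u).
  apply/rowP => i; rewrite pE !mxE; field.
  by rewrite ab0.
have -> : vertex a b f fa fb - fa = vinv p - vinv u.
  by rewrite /p /u !vinvK opprB addrA subrK.
have p0 : p != 0 by rewrite pE scaler_eq0 invr_eq0 (negPf ab0) subr_eq0.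
have pu0 : p != u.
  by rewrite -subr_eq0 puE scaler_eq0 (negPf uab) orbF mulf_neq0 ?invr_eq0.
by rewrite vinvB_vinv // puE vinvZ triZr invfM invrK mulrC.
Qed.

Lemma vertex_neq a b f fa fb : a != 0 -> generic_corner a b f fa fb ->
  vertex a b f fa fb != fa.
Proof.
move=> a0 [fa0 fb0 fab X0]; have [<-|ab] := eqVneq a b.
  by rewrite vertex_diag eq_sym.
apply: contra fab => /eqP vfa; have ab0 : a - b != 0 by rewrite subr_eq0.
have /eqP := vinv_vertexB f fa fb ab; rewrite vfa.
rewrite -(inj_eq (scalerI ab0)) scalerA divff // scale1r scalerBl.
rewrite (inj_eq (addIr _)) (inj_eq (scalerI a0)) (inj_eq (@vinv_inj _ _)).
by rewrite (inj_eq (addIr _)).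
Qed.

End Vertex.

(** * The cross-ratio equation and concircularity of the four vertices *)

Section CrossRatio.
Variables (R : realType) (n : nat).
Implicit Types (u v w x y f : 'rV[R]_n) (a b c : R).

(* Putting [f] at infinity turns the cross-ratio into a ratio of differences,
   so that the equation for the fourth vertex becomes affine. *)
Lemma cross_ratio_vinv f f1 f2 y : f1 != f -> f2 != f -> y != f -> y != f1 ->
  cross_ratio f f1 y f2 =
  (cvec (vinv (y - f) - vinv (f1 - f)))^-1 * cvec (vinv (y - f) - vinv (f2 - f)).
Proof.
rewrite -subr_eq0 => v1; rewrite -subr_eq0 => v2.
rewrite -subr_eq0 => v; rewrite -subr_eq0.
have -> : y - f1 = (y - f) - (f1 - f) by rewrite opprB addrA subrK.
move=> vv1; have Uvv1 := cvec_unit vv1.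
rewrite /cross_ratio.
have -> : f1 - y = - ((y - f) - (f1 - f)) by rewrite opprB opprB addrA subrK.
have -> : y - f2 = (y - f) - (f2 - f) by rewrite opprB addrA subrK.
rewrite -[f - f1]opprB.
move: {vv1} (f1 - f) (f2 - f) (y - f) v1 v2 v Uvv1 => v1 v2 v v10 v20 v0 Uvv1.
rewrite !(cvecD, cvecN, cvec_vinv) in Uvv1 *.
rewrite invrN mulrNN.
by have := invrB_mulrB (cvec_unit v0) (cvec_unit v10) (cvec_unit v20) Uvv1.
Qed.

Lemma cross_ratio_back f f1 f2 : f1 != f -> f2 != f -> cross_ratio f f1 f f2 = 1.
Proof.
rewrite -subr_eq0 => v1; rewrite -subr_eq0 => v2.
rewrite /cross_ratio -[f - f1]opprB -[f - f2]opprB !cvecN mulNr divrr ?cvec_unit //.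
by rewrite mulN1r opprK divrr // cvec_unit.
Qed.

Lemma cross_ratio_vertex a b f fa fb : a != 0 -> generic_corner a b f fa fb ->
  cross_ratio f fa (vertex a b f fa fb) fb = (b / a) *: 1.
Proof.
move=> a0 gen; have [fa0 fb0 fab X0] := gen; have [<-|ab] := eqVneq a b.
  by rewrite vertex_diag cross_ratio_back // divff // scale1r.
have ab0 : a - b != 0 by rewrite subr_eq0.
have yfa := vertex_neq a0 gen.
have qE := vinv_vertexB f fa fb ab; set y := vertex _ _ _ _ _ in yfa qE *.
have y0 : y != f.
  by rewrite -subr_eq0 -vinv_eq0 qE scaler_eq0 invr_eq0 (negPf ab0) subr_eq0.
rewrite cross_ratio_vinv //.
have -> : vinv (y - f) - vinv (fb - f) = (b / a) *: (vinv (y - f) - vinv (fa - f)).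
  by rewrite qE; apply/rowP => i; rewrite !mxE; field; rewrite ab0.
rewrite cvecZ -scalerAr mulVr // cvec_unit // subr_eq0.
by rewrite (inj_eq (@vinv_inj _ _)) (inj_eq (addIr _)).
Qed.

Lemma cross_ratio_vertexP a b f fa fb y : a != 0 -> b != 0 ->
  fa != f -> fb != f -> fa != fb -> y != fa ->
  cross_ratio f fa y fb = (b / a) *: 1 ->
  generic_corner a b f fa fb /\ y = vertex a b f fa fb.
Proof.
move=> a0 b0 fa0 fb0 fab yfa; have uab : vinv (fa - f) != vinv (fb - f).
  by rewrite (inj_eq (@vinv_inj _ _)) (inj_eq (addIr _)).
have diag : a = b -> a *: vinv (fb - f) != b *: vinv (fa - f).
  by move=> <-; rewrite (inj_eq (scalerI a0)) eq_sym.
have [->|y0] := eqVneq y f.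
  (* At [y = f] the cross-ratio is 1; comparing scalar parts gives a = b, where [vertex] is [f] by
     [vertex_diag]. *)
  rewrite cross_ratio_back // => /(congr1 (fun z : clifford R n => clifford_coef z finset.set0)).
  rewrite clifford_coefZ !clifford_coef1 eqxx mulr1 /= => ba.
  have ab : a = b by rewrite -[a]mul1r (ba : 1 = b / a) mulfVK.
  by split; [split=> //; exact: diag | rewrite ab vertex_diag].
rewrite cross_ratio_vinv //; set q := vinv (y - f) => cr.
have qa : q - vinv (fa - f) != 0.
  by rewrite subr_eq0 (inj_eq (@vinv_inj _ _)) (inj_eq (addIr _)).
have qb : q - vinv (fb - f) = (b / a) *: (q - vinv (fa - f)).
  apply: cvec_inj; rewrite -[LHS](mulVKr (cvec_unit qa)) cr -scalerAr mulr1.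
  by rewrite -cvecZ.
have {}qb : (a - b) *: q = a *: vinv (fb - f) - b *: vinv (fa - f).
  move/rowP: qb => qb; apply/rowP => i; have := qb i; rewrite !mxE.
  move/(congr1 (fun z => a * z)); rewrite /= mulrA [a * (b / a)]mulrCA divff // mulr1.
  move/eqP; rewrite -subr_eq0 => /eqP E.
  by apply/eqP; rewrite -subr_eq0; apply/eqP; rewrite -[RHS]E; ring.
have [ab|ab] := eqVneq a b.
  by case/eqP: (diag ab); apply/eqP; rewrite -subr_eq0 -qb ab subrr scale0r.
have ab0 : a - b != 0 by rewrite subr_eq0.
split.
  split=> //; rewrite -subr_eq0 -qb scaler_eq0 (negPf ab0).
  by rewrite vinv_eq0 subr_eq0.
rewrite /vertex -qb vinvZ scalerA divff // scale1r vinvK.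
by rewrite addrC subrK.
Qed.

(** Inversion maps a line through the origin to itself, and a line with nonzero foot of
    perpendicular [c] to the circle through the origin with diameter [vinv c]. *)
Lemma vinv_line_concircular f u e : e != 0 ->
  exists S, (is_circle S \/ is_line S) /\ S f /\
    forall t, u + t *: e != 0 -> S (f + vinv (u + t *: e)).
Proof.
move=> e0; have ee := dot_gt0 e0; have ee0 := lt0r_neq0 ee.
pose m := dot u e / dot e e; pose c := u - m *: e.
have ce : dot c e = 0 by rewrite /c !dotE /m mulfVK // subrr.
have uE t : u + t *: e = c + (m + t) *: e.
  by rewrite /c scalerDl addrA subrK.
clearbody c; have [c0|c0] := eqVneq c 0.
  exists [set f + t *: e | t in [set: R]]%classic; split; last split.
  - by right; exists f, e.
  - by exists 0 => //; rewrite scale0r addr0.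
  - move=> t _; rewrite uE c0 add0r vinvZ vinv.unlock scalerA.
    by eexists.
have cc := dot_gt0 c0; have cc0 := lt0r_neq0 cc.
pose C := Num.sqrt (dot c c); pose E := Num.sqrt (dot e e).
have C2 : C * C = dot c c by rewrite -expr2 sqr_sqrtr ?dot_ge0.
have E2 : E * E = dot e e by rewrite -expr2 sqr_sqrtr ?dot_ge0.
have Cp : 0 < C by rewrite sqrtr_gt0.
have Ep : 0 < E by rewrite sqrtr_gt0.
have C0 := lt0r_neq0 Cp; have E0 := lt0r_neq0 Ep.
exists [set (f + 2^-1 *: vinv c) + (2^-1 / C) *: (t.1 *: (C^-1 *: c) + t.2 *: (E^-1 *: e)) |
  t in [set t : R * R | t.1 ^+ 2 + t.2 ^+ 2 = 1]]%classic.
split; last split.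
- left; exists (f + 2^-1 *: vinv c), (C^-1 *: c), (E^-1 *: e), (2^-1 / C); split=> //.
  + by rewrite divr_gt0 ?invr_gt0.
  + by rewrite dotZl dotZr -C2; field.
  + by rewrite dotZl dotZr -E2; field.
  + by rewrite dotZl dotZr ce !mulr0.
(* [f] is the end of the diameter opposite to [f + vinv c], the limit of the points for t going to
   infinity. *)
- exists (1, 0) => /=; first by rewrite expr1n expr0n addr0.
  rewrite vinv.unlock -C2; apply/rowP => i; rewrite !mxE; field.
  by rewrite E0 C0.
- move=> t; rewrite uE => y0.
  pose s := m + t; pose N := dot c c + s * s * dot e e.
  have NE : dot (c + s *: e) (c + s *: e) = N.
    by rewrite !dotE (dotC e) ce /N; ring.
  have N0 : N != 0 by rewrite -NE dot_eq0.
  (* The rational parametrisation of the unit circle, found by comparing the coefficients of [c] and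
     [e] with those of - (c + s e) / N. *)
  exists ((s * s * dot e e - dot c c) / N, - (2 * C * E * s) / N) => /=.
    rewrite -[1](divff (mulf_neq0 N0 N0)); move: N0; rewrite /N -C2 -E2 => N0.
    by field.
  rewrite -/s !vinv.unlock NE; apply/rowP => i; rewrite !mxE.
  by move: N0; rewrite /N -C2 -E2 => N0; field; rewrite ?N0 ?C0 ?E0.
Qed.

(** With [f] at infinity the other three points sit at parameters 0, a / (a - b) and 1 of one line;
    for a = b the vertex is [f] itself. *)
Lemma concircular_vertex a b f fa fb : generic_corner a b f fa fb ->
  concircular f fa (vertex a b f fa fb) fb.
Proof.
move=> [fa0 fb0 fab X0]; pose u := vinv (fa - f).
have e0 : vinv (fb - f) - u != 0.
  by rewrite subr_eq0 (inj_eq (@vinv_inj _ _)) (inj_eq (addIr _)) eq_sym.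
have [S [cS [Sf Sy]]] := vinv_line_concircular f u e0.
exists S; split=> //; split=> //.
- have := Sy 0; rewrite scale0r addr0 vinvK subrKC; apply.
  by rewrite vinv_eq0 subr_eq0.
- have [->|ab] := eqVneq a b; first by rewrite vertex_diag.
  have ab0 : a - b != 0 by rewrite subr_eq0.
  have := vinv_vertexB f fa fb ab; set y := vertex _ _ _ _ _ => yE.
  have yE' : u + (a / (a - b)) *: (vinv (fb - f) - u) = vinv (y - f).
    by rewrite yE; apply/rowP => i; rewrite !mxE; field; rewrite ab0.
  have := Sy (a / (a - b)); rewrite yE' vinvK subrKC; apply.
  by rewrite yE scaler_eq0 invr_eq0 (negPf ab0) subr_eq0.
- have := Sy 1; rewrite scale1r subrKC vinvK subrKC; apply.
  by rewrite vinv_eq0 subr_eq0.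
Qed.

End CrossRatio.

(** * Three-dimensional consistency of the fourth-vertex construction *)

Section Cube.
Variables (R : realFieldType) (n : nat).
Implicit Types (f : 'rV[R]_n) (a b c : R).

Lemma vinvB_corner f fa fb : fa != f -> fb != f -> fa != fb ->
  let u := vinv (fa - f) in
  vinv (fb - fa) = - u - tri u (vinv (vinv (fb - f) - u)).
Proof.
move=> fa0 fb0 fab u; have u0 : u != 0 by rewrite vinv_eq0 subr_eq0.
have -> : fb - fa = vinv (vinv (fb - f)) - vinv u.
  by rewrite /u !vinvK opprB addrA subrK.
rewrite vinvB_vinv // ?vinv_eq0 ?subr_eq0 //.
by rewrite (inj_eq (@vinv_inj _ _)) (inj_eq (addIr _)) eq_sym.
Qed.

(** The quadrilateral can be completed from any corner: opposite edges carry the same parameter, so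
    at [fa] the edge to the vertex has [b] and the edge to [f] has [a]. For a = b the vertex is [f]
    and no longer remembers [fb]. *)
Lemma vertex_back a b f fa fb : a != 0 -> a != b -> generic_corner a b f fa fb ->
  vertex b a fa (vertex a b f fa fb) f = fb.
Proof.
move=> a0 ab gen; have [fa0 fb0 fab X0] := gen.
have ab0 : a - b != 0 by rewrite subr_eq0.
rewrite {1}/vertex vinv_vertexB_corner //.
set u := vinv (fa - f); set e := vinv (fb - f) - u.
have -> : b *: vinv (f - fa) - a *: (- u - ((a - b) / a) *: tri u (vinv e)) =
   (- (a - b)) *: vinv (fb - fa).
  rewrite (vinvB_corner fa0 fb0 fab) -/u -/e -[f - fa]opprB vinvN -/u.
  by apply/rowP => i; rewrite !mxE; field.
rewrite vinvZ vinvK scalerA -opprB mulfV ?scale1r ?subrKC //.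
by rewrite oppr_eq0.
Qed.

(* When [c] differs from [a] and [b], the inverted coordinates of the two sides
   based at [fa] and at [fc] are related by the change of base point
   [vinvB_vinv]; otherwise both sides reduce to [vertex_back]. *)
Lemma vertex_cube a b c f fa fb fc : a != 0 -> b != 0 -> c != 0 ->
  generic_corner a b f fa fb -> generic_corner a c f fa fc ->
  generic_corner b c f fb fc ->
  let fab := vertex a b f fa fb in
  let fac := vertex a c f fa fc in
  let fbc := vertex b c f fb fc in
  generic_corner b c fa fab fac -> generic_corner a b fc fac fbc ->
  vertex b c fa fab fac = vertex a b fc fac fbc.
Proof.
move=> a0 b0 c0 gab gac gbc fab fac fbc ga gc.
(* Equal parameters would make both neighbours [fab] and [fac] of [fa] equal to [f], against
   [ga]. *)
have abc : ~ (a = b /\ b = c).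
  case=> ab bc; case: ga => _ _ /eqP + _; apply.
  by rewrite /fab /fac -bc ab !vertex_diag.
have [ac|ac] := eqVneq a c.
  have ab : a != b by apply/eqP => ab; apply: abc; rewrite -ab ac.
  rewrite /fac /fbc -ac vertex_diag [LHS]vertex_back //.
  rewrite [in RHS]vertexC [vertex b a f fb fc]vertexC vertex_back //.
  by apply: generic_cornerC; rewrite ac.
have [bc|bc] := eqVneq b c.
  rewrite /fbc -bc !vertex_diag /fac -bc [vertex a b f fa fc]vertexC vertex_back //.
    by rewrite bc eq_sym.
  by apply: generic_cornerC; rewrite bc.
have [fa0 fb0 fafb _] := gab; have [_ fc0 fafc _] := gac.
have [_ _ fbfc _] := gbc.
have bc0 : b - c != 0 by rewrite subr_eq0.
pose u1 := vinv (fa - f); pose u2 := vinv (fb - f); pose u3 := vinv (fc - f).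
have u10 : u1 != 0 by rewrite vinv_eq0 subr_eq0.
have u30 : u3 != 0 by rewrite vinv_eq0 subr_eq0.
have neq x y : x != y -> vinv (x - f) != vinv (y - f).
  by rewrite (inj_eq (@vinv_inj _ _)) (inj_eq (addIr _)).
have u31 : u3 != u1 by apply: neq; rewrite eq_sym.
have u21 : u2 != u1 by apply: neq; rewrite eq_sym.
have u23 : u2 != u3 by apply: neq.
set y1 := LHS; set y2 := RHS.
pose w := vinv (y1 - fa); pose k := vinv (fc - fa).
have w0 : w != 0.
  by rewrite /w vinv_vertexB // scaler_eq0 invr_eq0 (negPf bc0) subr_eq0; case: ga.
have kE : k = - u1 - tri u1 (vinv (u3 - u1)) by apply: vinvB_corner.
have k0 : k != 0 by rewrite vinv_eq0 subr_eq0 eq_sym.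
(* In [w - k] the coefficients of the two inverses turn out to be - r and r. So [w - k] is a
   multiple of a difference of inverses, and a second change of base point applies. *)
pose r := (c * (a - b)) / (a * (b - c)).
have wk : w - k = (- r) *: tri u1 (vinv (u3 - u1) - vinv (u2 - u1)).
  rewrite /w vinv_vertexB // !vinv_vertexB_corner // -/u1 -/u2 -/u3 kE triBr.
  by apply/rowP => i; rewrite !mxE /r; field; rewrite a0 bc0.
have [ab|ab] := eqVneq a b.
  have wk0 : w = k.
    by apply/eqP; rewrite -subr_eq0 wk /r ab subrr mulr0 mul0r oppr0 scale0r.
  rewrite /y2 ab vertex_diag; move: wk0 => /vinv_inj /eqP.
  by rewrite (inj_eq (addIr _)) => /eqP.
have ab0 : a - b != 0 by rewrite subr_eq0.
have r0 : r != 0 by rewrite !mulf_neq0 ?invr_eq0 ?mulf_neq0.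
have e0 x y : x != y -> x - y != 0 by rewrite subr_eq0.
have wk0 : w != k.
  rewrite -subr_eq0 wk scaler_eq0 oppr_eq0 (negPf r0) tri_eq0 // subr_eq0.
  by rewrite (inj_eq (@vinv_inj _ _)) (inj_eq (addIr _)) eq_sym.
have y1E : vinv (y1 - fc) =
    - k + r^-1 *: tri u3 (vinv (u3 - u1) + vinv (u2 - u3)).
  have -> : y1 - fc = vinv w - vinv k.
    by rewrite /w /k !vinvK opprB addrA subrK.
  rewrite vinvB_vinv // wk vinvZ triZr vinv_tri //.
  rewrite -[vinv (u3 - u1) - _]opprB vinvN.
  rewrite vinvB_vinv ?e0 //; last by rewrite (inj_eq (addIr _)).
  have -> : u2 - u1 - (u3 - u1) = u2 - u3 by rewrite opprB addrA subrK.
  have -> : - (- (u3 - u1) - tri (u3 - u1) (vinv (u2 - u3))) =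
     tri (u3 - u1) (vinv (u3 - u1) + vinv (u2 - u3)).
    by rewrite triDr tri_vinv opprB opprK addrC.
  have -> : k = vinv (vinv u3 - vinv u1).
    by rewrite /u1 /u3 !vinvK opprB addrA subrK.
  by rewrite tri_vinvB_vinv // invrN scaleNr opprK.
have kE' : k = u3 - tri u3 (vinv (u3 - u1)).
  rewrite /k -[fc - fa]opprB vinvN.
  have -> : vinv (fa - fc) = - u3 - tri u3 (vinv (u1 - u3)).
    by apply: vinvB_corner; rewrite // eq_sym.
  rewrite -[u1 - u3]opprB vinvN triNr.
  by apply/rowP => i; rewrite !mxE; ring.
have acE := vertexC a c f fa fc; have bcE := vertexC b c f fb fc.
suff : vinv (y1 - fc) = vinv (y2 - fc).
  by move/vinv_inj/eqP; rewrite (inj_eq (addIr _)) => /eqP.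
(* Both sides are now combinations of [u3] and of [tri u3] at the inverses of [u3 - u1] and
   [u2 - u3]; only scalar coefficients remain to be compared. *)
rewrite y1E kE' /y2 vinv_vertexB // /fac /fbc acE bcE.
rewrite !vinv_vertexB_corner //; try exact: generic_cornerC.
rewrite -/u1 -/u2 -/u3 -[u1 - u3]opprB vinvN triNr triDr.
by apply/rowP => i; rewrite !mxE /r; field; rewrite ?a0 ?b0 ?c0 ?ab0 ?bc0.
Qed.

End Cube.

(** * Smooth maps *)

Local Open Scope classical_set_scope.

Section Smoothness.
Variables (R : realType) (V : normedModType R) (M : set V).
Hypothesis openM : open M.

(** [Ck] for arbitrary normed source and target, so that it also applies to real-valued coordinates,
    inner products and inverses. *)
Fixpoint Cn (W : normedModType R) (k : nat) (f : V -> W) : Prop :=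
  match k with
  | 0 => forall z, M z -> {for z, continuous f}
  | k'.+1 => (forall z, M z -> differentiable f z) /\
             (forall X : V, Cn k' (fun z => 'D_X f z))
  end.

(** Differentiability is made local by splitting off a difference that vanishes near the point. *)
Lemma differentiable_near0 (W : normedModType R) (f : V -> W) z :
  (\forall w \near z, f w = 0) -> differentiable f z.
Proof.
move=> f0; have fE : f \o shift z = cst (f z) + 0 +o_ (0 : V) id.
  apply: eqaddoE; apply/eqaddoP => _/posnumP[e] /=.
  rewrite (nbhs_singleton f0); near=> h; rewrite /= !fctE /=.
  have -> : f (h + z) = 0.
    by near: h; move: f0; rewrite (near_shift 0) /= subr0.
  by rewrite addr0 subrr normr0 mulr_ge0.
have d0 : 'd f z = 0 :> (V -> W).
  by apply: diff_unique => // x; exact: cst_continuous.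
by apply/diff_locallyP; rewrite d0; split=> // x; exact: cst_continuous.
Unshelve. all: by end_near. Qed.

Lemma near_eq_differentiable (W : normedModType R) (f g : V -> W) z :
  (\forall w \near z, f w = g w) -> differentiable f z -> differentiable g z.
Proof.
move=> fg df; have -> : g = f + (g - f) by rewrite addrC subrK.
apply: (differentiableD df); apply: differentiable_near0.
by near=> w; rewrite !fctE (near fg w) ?subrr.
Unshelve. all: by end_near. Qed.

Lemma near_open (P : V -> Prop) : (forall z, M z -> P z) ->
  forall z, M z -> \forall w \near z, P w.
Proof.
by move=> MP z Mz; apply: (filterS MP); apply: open_nbhs_nbhs; split.
Qed.

Lemma Cn_eq (W : normedModType R) k (f g : V -> W) :
  (forall z, M z -> f z = g z) -> Cn k f -> Cn k g.
Proof.
elim: k f g => [|k IH] f g fg /= => [cf z Mz|[df Df]].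
  rewrite /prop_for /continuous_at -(fg _ Mz).
  by apply: cvg_trans (cf z Mz); apply: near_eq_cvg; exact: near_open.
split=> [z Mz|X].
  by apply: near_eq_differentiable (df z Mz); exact: near_open.
apply: IH (Df X) => z Mz; apply: near_eq_derive; exact: near_open.
Qed.

Lemma CnS (W : normedModType R) k (f : V -> W) : Cn k.+1 f -> Cn k f.
Proof.
elim: k f => [|k IH] f [df Df].
  by move=> z Mz; apply: differentiable_continuous; exact: df.
by split=> // X; apply: IH; exact: Df.
Qed.

Lemma Cn_cst (W : normedModType R) k (c : W) : Cn k (fun=> c).
Proof.
elim: k c => [|k IH] c /=; first by move=> z _; exact: cst_continuous.
split=> [z _|X]; first exact: differentiable_cst.
apply: (@Cn_eq _ _ (fun=> 0)) => // z _.
by rewrite derive_cst.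
Qed.

Lemma CnD (W : normedModType R) k (f g : V -> W) :
  Cn k f -> Cn k g -> Cn k (fun z => f z + g z).
Proof.
elim: k f g => [|k IH] f g /= => [cf cg z Mz|[df Df] [dg Dg]].
  by apply: cvgD; [exact: cf|exact: cg].
split=> [z Mz|X]; first by apply: differentiableD; [exact: df|exact: dg].
apply: Cn_eq (IH _ _ (Df X) (Dg X)) => z Mz.
by rewrite deriveD //; apply: diff_derivable; [exact: df|exact: dg].
Qed.

Lemma CnM k (f g : V -> R) :
  Cn k f -> Cn k g -> Cn k (fun z => f z * g z).
Proof.
elim: k f g => [|k IH] f g => [cf cg z Mz|Cf Cg].
  by apply: cvgM; [exact: cf|exact: cg].
have [[df Df] [dg Dg]] := (Cf, Cg).
split=> [z Mz|X]; first by apply: differentiableM; [exact: df|exact: dg].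
have fDg : Cn k (fun z => f z * 'D_X g z).
  by apply: IH; [exact: CnS Cf|exact: Dg].
have gDf : Cn k (fun z => g z * 'D_X f z).
  by apply: IH; [exact: CnS Cg|exact: Df].
apply: Cn_eq (CnD fDg gDf) => z Mz.
by rewrite deriveM //; apply: diff_derivable; [exact: df|exact: dg].
Qed.

(** Unlike for products, the induction keeps [f] fixed: the derivative - f^-1 f^-1 Df involves the
    inverse of the same [f], one order lower. *)
Lemma CnV k (f : V -> R) : (forall z, M z -> f z != 0) ->
  Cn k f -> Cn k (fun z => (f z)^-1).
Proof.
move=> f0; elim: k => [|k IH] => [cf z Mz|Cf].
  by apply: cvgV; [exact: f0|exact: cf].
have [df Df] := Cf.
split=> [z Mz|X]; first by apply: differentiableV; [exact: df|exact: f0].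
have CfV := IH (CnS Cf).
have CfVV := CnM (CnM (@Cn_cst R^o k (- 1)) (CnM CfV CfV)) (Df X).
apply: Cn_eq CfVV => z Mz.
rewrite deriveV ?f0 //; last by apply: diff_derivable; exact: df.
by rewrite expr2 invfM mulN1r.
Qed.

Lemma Cn_coord n k (f : V -> 'rV[R]_n) :
  Cn k f <-> forall j, Cn k (fun z => f z 0 j).
Proof.
have dE j (g : V -> 'rV[R]_n) z : differentiable g z ->
    differentiable (fun w => g w 0 j) z.
  move=> dg; apply: (@differentiable_comp _ _ _ _ g (fun N : 'rV[R]_n => N 0 j)) => //.
  exact: differentiable_coord.
split.
  elim: k f => [|k IH] f /= => [cf j z Mz|[df Df] j].
    apply: (@continuous_comp _ _ _ f (fun N : 'rV[R]_n => N 0 j) z (cf z Mz)).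
    exact: coord_continuous.
  split=> [z Mz|X]; first exact/dE/df.
  apply: Cn_eq (IH _ (Df X) j) => z Mz.
  by rewrite derive_mx ?mxE //; apply/diff_derivable/df.
have sumE (g : V -> 'rV[R]_n) : g = \sum_(j < n) (fun z => g z 0 j *: delta_mx 0 j).
  by apply/funext => z; rewrite fct_sumE {1}[g z]row_sum_delta.
elim: k f => [|k IH] f Cf.
  move=> z Mz; rewrite [f]sumE.
  elim/big_ind : _ => [|g h cg ch|j _].
  - exact: cst_continuous.
  - exact: cvgD.
  - by apply: cvgZr_tmp; exact: Cf.
split=> [z Mz|X].
  rewrite [f]sumE; apply: differentiable_sum => j; apply: differentiableZl.
  by case: (Cf j) => + _; apply.
apply: IH => j; have [df Df] := Cf j; apply: Cn_eq (Df X) => z Mz.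
rewrite derive_mx ?mxE //; apply/derivable_mxP => i l; rewrite ord1.
by apply: diff_derivable; case: (Cf l) => + _; apply.
Qed.

End Smoothness.

Section SmoothVectors.
Variables (R : realType) (n : nat).
Local Notation plane := (R * R)%type.
Local Notation vec := 'rV[R]_n.
Implicit Types (M U : set plane) (f g : plane -> vec).

Lemma CkE k M f : Ck k M f <-> Cn M k f.
Proof.
elim: k f => [|k IH] f //=.
by split=> -[df Df]; split=> // X; apply/IH.
Qed.

Lemma smooth_coord M f : open M ->
  smooth M f <-> forall j k, Cn M k (fun z => f z 0 j).
Proof.
move=> oM; split=> [sf j k|sf k].
  by move: j; apply/(Cn_coord oM)/CkE.
by apply/CkE/(Cn_coord oM) => j.
Qed.

Lemma smooth_sub M U f : U `<=` M -> smooth M f -> smooth U f.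
Proof.
move=> UM sf k; elim: k f {sf}(sf k) => [|k IH] f /= => [cf z Uz|[df Df]].
  exact/cf/UM.
by split=> [z Uz|X]; [exact/df/UM | exact: IH].
Qed.

Lemma smooth_eq M f g : open M -> (forall z, M z -> f z = g z) ->
  smooth M f -> smooth M g.
Proof.
by move=> oM fg sf k; apply/CkE; apply: (Cn_eq oM fg); apply/CkE.
Qed.

Lemma smooth_continuous M f : smooth M f -> forall z, M z -> {for z, continuous f}.
Proof. by move=> /(_ 0%N). Qed.

Lemma smooth_differentiable M f : smooth M f -> forall z, M z -> differentiable f z.
Proof. by move=> /(_ 1%N) []. Qed.

Lemma smooth_derivable M f : smooth M f -> forall z X, M z -> derivable f z X.
Proof. by move=> sf z X Mz; apply/diff_derivable/(smooth_differentiable sf). Qed.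

Lemma smoothD M f g : open M -> smooth M f -> smooth M g ->
  smooth M (fun z => f z + g z).
Proof.
by move=> oM sf sg k; apply/CkE; apply: CnD => //; apply/CkE.
Qed.

Lemma smoothZ M c f : open M -> smooth M f -> smooth M (fun z => c *: f z).
Proof.
move=> oM /(smooth_coord f oM) sf; apply/(smooth_coord _ oM) => j k.
apply: (Cn_eq oM _ (CnM oM (@Cn_cst _ _ _ oM R^o k c) (sf j k))) => z _.
by rewrite mxE.
Qed.

Lemma smoothB M f g : open M -> smooth M f -> smooth M g ->
  smooth M (fun z => f z - g z).
Proof.
move=> oM sf /(smoothZ (-1) oM) sg; apply: smooth_eq (smoothD oM sf sg) => // z _.
by rewrite scaleN1r.
Qed.

Lemma Cn_dot M f g k : open M -> smooth M f -> smooth M g ->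
  Cn M k (fun z => dot (f z) (g z)).
Proof.
move=> oM /(smooth_coord f oM) sf /(smooth_coord g oM) sg; rewrite /dot.
elim: (index_enum _) => [|j s IH].
  by apply: (Cn_eq oM _ (@Cn_cst _ _ _ oM R^o k 0)) => z _; rewrite big_nil.
apply: (Cn_eq oM _ (CnD oM (CnM oM (sf j k) (sg j k)) IH)) => z _.
by rewrite big_cons.
Qed.

Lemma smooth_vinv M f : open M -> (forall z, M z -> f z != 0) -> smooth M f ->
  smooth M (fun z => vinv (f z)).
Proof.
move=> oM f0 sf; apply/(smooth_coord _ oM) => j k.
have Cd : Cn M k (fun z => (dot (f z) (f z))^-1).
  apply: CnV => // [z Mz|]; first by rewrite dot_eq0 f0.
  exact: Cn_dot.
move: sf => /(smooth_coord f oM) sf.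
apply: (Cn_eq oM _ (CnM oM (@Cn_cst _ _ _ oM R^o k (-1)) (CnM oM Cd (sf j k)))) => z _.
by rewrite vinv.unlock mxE mulN1r mulNr.
Qed.

Lemma smooth_vertex M a b f fa fb : open M ->
  smooth M f -> smooth M fa -> smooth M fb ->
  (forall z, M z -> generic_corner a b (f z) (fa z) (fb z)) ->
  smooth M (fun z => vertex a b (f z) (fa z) (fb z)).
Proof.
move=> oM sf sfa sfb gen.
have su g : smooth M g -> (forall z, M z -> g z != f z) ->
    smooth M (fun z => vinv (g z - f z)).
  move=> sg gf; apply: smooth_vinv => // [z Mz|]; first by rewrite subr_eq0 gf.
  exact: smoothB.
apply: smoothD => //; apply: smoothZ => //; apply: smooth_vinv => // [z Mz|].
  by rewrite subr_eq0; case: (gen z Mz).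
apply: smoothB => //; apply: smoothZ => //; apply: su => // z Mz.
  by case: (gen z Mz).
by case: (gen z Mz).
Qed.

Lemma is_derive_coord f z X df : is_derive z X f df <->
  forall j, is_derive z X (fun w => f w 0 j) (df 0 j).
Proof.
split=> [[Df <-] j|Df].
  rewrite derive_mx // mxE; apply: derivableP.
  exact: (derivable_mxP f z X).1.
have D : derivable f z X.
  by apply/derivable_mxP => i j; rewrite ord1; case: (Df j).
apply: DeriveDef => //; apply/rowP => j; rewrite derive_mx // mxE.
by apply: derive_val; exact: Df.
Qed.

Lemma is_derive_dot f g z X df dg : is_derive z X f df -> is_derive z X g dg ->
  is_derive z X (fun w => dot (f w) (g w)) (dot df (g z) + dot (f z) dg).
Proof.
move=> /is_derive_coord Df /is_derive_coord Dg; rewrite /dot -big_split /=.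
elim: (index_enum _) => [|j s IH].
  under eq_fun do rewrite big_nil.
  by rewrite big_nil; exact: is_derive_cst.
under eq_fun do rewrite big_cons.
rewrite big_cons; apply: is_deriveD.
apply: is_derive_eq (is_deriveM (Df j) (Dg j)) _.
by rewrite /GRing.scale /= addrC [_ * df 0 j]mulrC.
Qed.

(** The noncommutative rule d(v^-1) = - v^-1 dv v^-1, obtained in coordinates from the quotient
    formula for [vinv]. *)
Lemma is_derive_vinv f z X df : f z != 0 -> is_derive z X f df ->
  is_derive z X (fun w => vinv (f w)) (- tri (vinv (f z)) df).
Proof.
move=> f0 Df; have d0 : dot (f z) (f z) != 0 by rewrite dot_eq0.
have DV : is_derive z X (fun w => (dot (f w) (f w))^-1)
    (- (dot (f z) (f z)) ^- 2 * (dot df (f z) + dot (f z) df)).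
  have Dd := is_derive_dot Df Df.
  apply: DeriveDef; first exact: derivableV.
  by rewrite deriveV // derive_val.
apply/is_derive_coord => j; have Dj := (is_derive_coord f z X df).1 Df j.
have -> : (fun w => vinv (f w) 0 j) =
    - ((fun w => (dot (f w) (f w))^-1) * (fun w => f w 0 j)).
  by apply/funext => w; rewrite vinv.unlock mxE mulNr.
apply: is_derive_eq (is_deriveN (is_deriveM DV Dj)) _.
rewrite vinv.unlock tri.unlock /GRing.scale /= !mxE !dotE (dotC df); field; exact: d0.
Qed.

End SmoothVectors.

(** * Isothermic surfaces and Darboux transforms *)

Lemma conj_polar (A : pzRingType) (x y t : A) :
  (x + y) * t * (x + y) - x * t * x - y * t * y = x * t * y + y * t * x.
Proof.
rewrite 2!mulrDl !mulrDr; apply/eqP; rewrite 2!subr_eq; apply/eqP.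
by rewrite -[LHS]addrA addrC -!addrA.
Qed.

(** * Pointwise algebra of the condition that the wedge product vanishes *)

Section ChristoffelAlgebra.
Variables (R : realFieldType) (n : nat).
Implicit Types x y s t : 'rV[R]_n.

(** The scalar part of a product does not depend on the order of the factors, so [cvecC] counts it
    twice. *)
Lemma clifford_coef0_cvecM x y :
  clifford_coef (cvec x * cvec y) finset.set0 = - dot x y.
Proof.
have sym : clifford_coef (cvec y * cvec x) finset.set0 =
           clifford_coef (cvec x * cvec y) finset.set0.
  have E (v w : clifford R n) : clifford_coef (v * w) finset.set0 =
      \sum_A clifford_sign R A A * clifford_coef v A * clifford_coef w A.
    rewrite [LHS](clifford_coefM v w finset.set0).
    apply: eq_bigr => A _.
    by rewrite symdiff0.
  rewrite (E (cvec x)).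
  rewrite (E (cvec y)).
  apply: eq_bigr => A _.
  by rewrite mulrAC.
have := congr1 (fun z : clifford R n => clifford_coef z finset.set0) (cvecC x y).
rewrite /= clifford_coefD sym clifford_coefZ clifford_coef1 eqxx mulr1 -mulr2n.
rewrite -mulNrn -[LHS]mulr_natr -[RHS]mulr_natr; apply: mulIf.
by rewrite pnatr_eq0.
Qed.

Lemma cvecM_eq_dot x y s t : cvec x * cvec t = cvec y * cvec s -> dot x t = dot y s.
Proof.
move=> /(congr1 (fun z : clifford R n => clifford_coef z finset.set0)).
by rewrite /= !clifford_coef0_cvecM => /oppr_inj.
Qed.

Lemma cvecM_eq_rev x y s t : cvec x * cvec t = cvec y * cvec s ->
  cvec t * cvec x = cvec s * cvec y.
Proof. by move=> e; rewrite (cvecM_anti x) (cvecM_anti y) e (cvecM_eq_dot e). Qed.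

Lemma tri_polar x y t : tri (x + y) t - tri x t - tri y t =
  2 *: (dot x y *: t - dot x t *: y - dot y t *: x).
Proof.
rewrite tri.unlock; apply/rowP => i; rewrite !mxE !dotE (dotC y x); ring.
Qed.

(* [2 y s y = x t y + y t x], whose right-hand side is a polarised [tri]. *)
Lemma cvecM_eq_frame x y s t : dot x y = 0 ->
  cvec x * cvec t = cvec y * cvec s ->
  dot y y *: s = dot y s *: y - dot y t *: x.
Proof.
move=> xy e; have e' := cvecM_eq_rev e.
have : 2 *: tri y s = tri (x + y) t - tri x t - tri y t.
  apply: cvec_inj; rewrite cvecZ !(cvec_tri, cvecD, cvecN) conj_polar.
  by rewrite scaler_nat mulr2n -[cvec y * cvec t * cvec x]mulrA e' e mulrA.
rewrite tri_polar xy scale0r sub0r (cvecM_eq_dot e) tri.unlock => /rowP E.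
apply/rowP => i; have := E i; rewrite !mxE => {}E; lra.
Qed.

(** Here [x, y] are the partial derivatives of f and [s, t] those of f^c: the tangent planes are
    parallel, and df^c is df followed by an orientation-reversing conformal map, given by two
    numbers. *)
Lemma cvecM_eq_orthogonal l x y s t : l != 0 ->
  dot x x = l -> dot y y = l -> dot x y = 0 ->
  cvec x * cvec t = cvec y * cvec s ->
  [/\ dot y s = dot x t, dot y t = - dot x s,
      l *: s = dot x s *: x + dot x t *: y &
      l *: t = dot x t *: x - dot x s *: y].
Proof.
move=> l0 xx yy xy e; have xt := cvecM_eq_dot e.
have sE := cvecM_eq_frame xy e; have yx : dot y x = 0 by rewrite dotC.
have tE := cvecM_eq_frame yx (esym e).
have xs : dot y t = - dot x s.
  apply: (mulfI l0); rewrite -{1}xx -dotZr tE dotDr dotNr !dotZr yy yx.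
  by rewrite mulr0 sub0r mulrN mulrC.
split=> //; first by rewrite -yy sE -xt xs scaleNr opprK addrC.
by rewrite -xx tE.
Qed.

End ChristoffelAlgebra.

Local Open Scope complex_scope.

Section Isothermic.
Variables (R : realType) (n : nat).
Local Notation plane := (R * R)%type.
Local Notation vec := 'rV[R]_n.
Implicit Types (M U : set plane) (Q : plane -> R[i]) (f g : plane -> vec).
Implicit Types (z X Y : plane) (alpha beta : Defs.form R n).

Lemma dform_linear f z X : differentiable f z ->
  dform f z X = X.1 *: dform f z (1, 0) + X.2 *: dform f z (0, 1).
Proof.
move=> df; rewrite /dform !deriveE //.
have XE : X = X.1 *: ((1, 0) : plane) + X.2 *: ((0, 1) : plane).
  case: X => a b; rewrite (_ : _ + _ = (a * 1 + b * 0, a * 0 + b * 1)) //.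
  by rewrite !mulr1 !mulr0 addr0 add0r.
by rewrite {1}XE linearD !linearZ.
Qed.

Lemma sum_complex m (F G : 'I_m -> R) :
  \sum_j (F j +i* G j) = (\sum_j F j) +i* (\sum_j G j).
Proof.
elim: (index_enum _) => [|j s IH]; first by rewrite !big_nil.
by rewrite !big_cons IH.
Qed.

Lemma form20E alpha beta z :
  form20 alpha beta z =
  ((dot (alpha z (1, 0)) (beta z (1, 0)) - dot (alpha z (0, 1)) (beta z (0, 1))) / 4) +i*
  (- (dot (alpha z (1, 0)) (beta z (0, 1)) + dot (alpha z (0, 1)) (beta z (1, 0))) / 4).
Proof.
have two : (2 : R[i])^-1 = (2^-1)%:C by rewrite fmorphV rmorph_nat.
rewrite /form20 /dot -sumrB -big_split -sumrN !mulr_suml -sum_complex.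
apply: eq_bigr => j _; rewrite !mxE two.
by apply/eqP; rewrite eq_complex /=; apply/andP; split; apply/eqP; field.
Qed.

(** Since Q = (A - iB) / 2, the differential of f^c is determined by df and Q. This gives both its
    uniqueness and its nonvanishing where Q is nonzero. *)
Lemma christoffel_frame M Q f fc z : christoffel M Q f fc ->
  conformal_at f z -> immersion_at f z -> M z ->
  exists l A B, [/\ 0 < l,
    forall X Y,
      dot (dform f z X) (dform f z Y) = l * (X.1 * Y.1 + X.2 * Y.2),
    l *: dform fc z (1, 0) = A *: dform f z (1, 0) + B *: dform f z (0, 1),
    l *: dform fc z (0, 1) = B *: dform f z (1, 0) - A *: dform f z (0, 1) &
    Q z = (A / 2) +i* (- B / 2)].
Proof.
move=> [_ wedge Qz] [l l0 conf] imm Mz.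
have x0 : dform f z (1, 0) != 0.
  by apply/eqP => /imm [] /eqP; rewrite oner_eq0.
have xx := conf (1, 0) (1, 0); have yy := conf (0, 1) (0, 1).
have xy := conf (1, 0) (0, 1).
rewrite /= !(mulr0, mulr1, addr0, add0r) in xx yy xy.
have e := wedge z (1, 0) (0, 1) Mz; rewrite /clifford_wedge in e.
have q := Qz z Mz; rewrite form20E in q.
exists l; rewrite -q; move: x0 xx yy xy e {wedge Qz imm q}.
move: (dform f z (1, 0)) (dform f z (0, 1)) (dform fc z (1, 0)) (dform fc z (0, 1)).
move=> x y s t x0 xx yy xy e.
have lp : 0 < l by rewrite -xx dot_gt0.
have {}e : cvec x * cvec t = cvec y * cvec s by apply/eqP; rewrite -subr_eq0 e.
have [ys yt sE tE] := cvecM_eq_orthogonal (lt0r_neq0 lp) xx yy xy e.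
exists (dot x s), (dot x t); split=> //; rewrite ys yt.
by apply/eqP; rewrite eq_complex /=; apply/andP; split; apply/eqP; field.
Qed.

End Isothermic.

Section DarbouxPairs.
Variables (R : realType) (n : nat).
Local Notation plane := (R * R)%type.
Local Notation vec := 'rV[R]_n.
Implicit Types (M U : set plane) (Q : plane -> R[i]) (f g fc : plane -> vec).
Implicit Types (z X Y : plane) (a b r : R).

(** The Christoffel transform is fixed once and for all, on a set without zeros of Q, where f and
    f^c are both immersed. *)
Definition isothermic_pair U Q f fc :=
  [/\ isothermic U Q f, christoffel U Q f fc & forall z, U z -> Q z != 0].

(* The Riccati equation of [g = f' - f], rewritten as [df' = r g df^c g]. *)
Definition darboux_pair U r f fc f' :=
  smooth U f' /\ forall z X, U z -> 'D_X f' z = r *: tri (f' z - f z) ('D_X fc z).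

Lemma isothermic_pair_frame U Q f fc z : isothermic_pair U Q f fc -> U z ->
  exists l A B, [/\ 0 < l,
    forall X Y, dot (dform f z X) (dform f z Y) = l * (X.1 * Y.1 + X.2 * Y.2),
    l *: dform fc z (1, 0) = A *: dform f z (1, 0) + B *: dform f z (0, 1),
    l *: dform fc z (0, 1) = B *: dform f z (1, 0) - A *: dform f z (0, 1) &
    Q z = (A / 2) +i* (- B / 2)].
Proof.
move=> [[_ conf imm _] cf Q0] Uz.
exact: christoffel_frame cf (conf z Uz) (imm z Uz (Q0 z Uz)) Uz.
Qed.

Lemma isothermic_pair_smooth U Q f fc : isothermic_pair U Q f fc ->
  smooth U f /\ smooth U fc.
Proof. by case=> -[? _ _ _] [? _ _] _. Qed.

Lemma christoffel_sub M U Q f fc : U `<=` M -> christoffel M Q f fc ->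
  christoffel U Q f fc.
Proof.
by move=> UM [sfc w q]; split=> [|z X Y /UM|z /UM]; [exact: smooth_sub sfc|exact: w|exact: q].
Qed.

Lemma isothermic_sub M U Q f : U `<=` M -> isothermic M Q f -> isothermic U Q f.
Proof.
move=> UM [sf conf imm [fc cf]]; split=> [|z /UM|z /UM|].
- exact: smooth_sub sf.
- exact: conf.
- exact: imm.
- by exists fc; exact: christoffel_sub cf.
Qed.

Lemma isothermic_pair_sub M U Q f fc : U `<=` M ->
  isothermic_pair M Q f fc -> isothermic_pair U Q f fc.
Proof.
move=> UM [pf cf Q0]; split=> [||z /UM]; last exact: Q0.
  exact: isothermic_sub pf.
exact: christoffel_sub cf.
Qed.

Lemma darboux_pair_sub M U r f fc f' : U `<=` M ->
  darboux_pair M r f fc f' -> darboux_pair U r f fc f'.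
Proof.
by move=> UM [sf' df']; split=> [|z X /UM]; [exact: smooth_sub sf' | exact: df'].
Qed.

Lemma christoffel_unique U Q f fc fc' z X : isothermic_pair U Q f fc ->
  christoffel U Q f fc' -> U z -> 'D_X fc' z = 'D_X fc z.
Proof.
move=> pf cf' Uz; have pf' : isothermic_pair U Q f fc'.
  by case: pf => pf _ Q0; split.
have [_ /smooth_differentiable dfc] := isothermic_pair_smooth pf.
have [_ /smooth_differentiable dfc'] := isothermic_pair_smooth pf'.
have [l [A [B [lp conf sE tE QE]]]] := isothermic_pair_frame pf Uz.
have [l' [A' [B' [lp' conf' sE' tE' QE']]]] := isothermic_pair_frame pf' Uz.
have ll : l' = l.
  by have := conf (1, 0) (1, 0); rewrite conf' /= !(mulr0, mulr1, addr0).
have two : (2 : R) != 0 by rewrite pnatr_eq0.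
have [AA BB] : A' = A /\ B' = B.
  move: QE'; rewrite QE => -[/(mulIf (invr_neq0 two)) -> ].
  by move/(mulIf (invr_neq0 two))/oppr_inj ->.
have l0 := lt0r_neq0 lp.
have ss : dform fc' z (1, 0) = dform fc z (1, 0).
  by apply: (scalerI l0); rewrite sE -{1}ll sE' AA BB.
have tt : dform fc' z (0, 1) = dform fc z (0, 1).
  by apply: (scalerI l0); rewrite tE -{1}ll tE' AA BB.
have := dform_linear X (dfc' z Uz); rewrite ss tt.
by have := dform_linear X (dfc z Uz); rewrite /dform => <-.
Qed.

(** [darboux] allows any Christoffel transform; they all have the same differential here, so the
    chosen [fc] can be used. *)
Lemma darbouxP U Q r f fc f' : open U -> isothermic_pair U Q f fc ->
  darboux U Q r f f' <-> darboux_pair U r f fc f'.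
Proof.
move=> oU pf; have [sf sfc] := isothermic_pair_smooth pf.
have DB g h z X : smooth U g -> smooth U h -> U z ->
    'D_X (fun w => g w + h w) z = 'D_X g z + 'D_X h z.
  by move=> sg sh Uz; rewrite deriveD //; apply: smooth_derivable Uz.
split=> [[fc0 [g [cf0 sg dg f'E]]]|[sf' df']].
  have sf' : smooth U f'.
    by apply: (smooth_eq oU _ (smoothD oU sf sg)) => z Uz; rewrite f'E.
  split=> // z X Uz.
  have -> : 'D_X f' z = 'D_X (fun w => f w + g w) z.
    by apply: near_eq_derive; exact: near_open f'E z Uz.
  rewrite DB // f'E // [f z + g z]addrC addrK.
  apply: cvec_inj; rewrite cvecD.
  have := dg z X Uz; rewrite /dform (christoffel_unique X pf cf0 Uz) => ->.
  by rewrite cvecZ cvec_tri subrKC.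
exists fc, (fun z => f' z - f z); split=> //.
- by case: pf.
- exact: smoothB.
- move=> z X Uz; have -> : dform (fun w => f' w - f w) z X = 'D_X f' z - 'D_X f z.
    rewrite /dform deriveB //; exact: smooth_derivable Uz.
  by rewrite df' // cvecD cvecN cvecZ cvec_tri.
- by move=> z _; rewrite subrKC.
Qed.

Lemma is_derive_vinvB U Q r f fc f' z X : isothermic_pair U Q f fc ->
  darboux_pair U r f fc f' -> U z -> f' z != f z ->
  is_derive z X (fun w => vinv (f' w - f w))
    (tri (vinv (f' z - f z)) ('D_X f z) - r *: 'D_X fc z).
Proof.
move=> pf [sf' df'] Uz ff'; have [sf sfc] := isothermic_pair_smooth pf.
have D : is_derive z X (fun w => f' w - f w) ('D_X f' z - 'D_X f z).
  by apply: is_deriveB; apply: derivableP; apply: smooth_derivable Uz.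
have g0 : f' z - f z != 0 by rewrite subr_eq0.
apply: is_derive_eq (is_derive_vinv g0 D) _.
by rewrite df' // triBr triZr trivK // opprB.
Qed.

End DarbouxPairs.

(** * Algebra of the transformed differentials *)

Section DualAlgebra.
Variables (R : realFieldType) (n : nat).
Implicit Types (x y s t g e : 'rV[R]_n) (l r a b c : R).

Lemma frame_dual l A B x y s t : l != 0 ->
  dot x x = l -> dot y y = l -> dot x y = 0 ->
  l *: s = A *: x + B *: y -> l *: t = B *: x - A *: y ->
  [/\ dot s s = (A ^+ 2 + B ^+ 2) / l, dot t t = (A ^+ 2 + B ^+ 2) / l & dot s t = 0].
Proof.
move=> l0 xx yy xy sE tE; have yx : dot y x = 0 by rewrite dotC.
have E (u v : 'rV[R]_n) : dot u v = dot (l *: u) (l *: v) / (l * l).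
  by rewrite dotZl dotZr; field.
rewrite (E s s) (E t t) (E s t) sE tE !dotE xx yy xy yx.
by split; field.
Qed.

(** The inner factors [g] and [g^-1] cancel; what is left is the reversed wedge relation conjugated
    by [g]. *)
Lemma tri_wedge r g x y s t : r != 0 -> g != 0 ->
  cvec x * cvec t = cvec y * cvec s ->
  cvec (r *: tri g s) * cvec (r^-1 *: tri (vinv g) y) =
  cvec (r *: tri g t) * cvec (r^-1 *: tri (vinv g) x).
Proof.
move=> r0 g0 /cvecM_eq_rev e; have Ug := cvec_unit g0.
have E (v w : 'rV[R]_n) : cvec (r *: tri g v) * cvec (r^-1 *: tri (vinv g) w) =
    cvec g * (cvec v * cvec w) / cvec g.
  rewrite !cvecZ !cvec_tri cvec_vinv -scalerAl -scalerAr scalerA divff // scale1r.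
  by rewrite !mulrA mulrK.
by rewrite !E -e.
Qed.

Lemma dot_tri_dual r g x s : r != 0 -> g != 0 ->
  dot (r *: tri g s) (r^-1 *: tri (vinv g) x) = dot x s.
Proof.
by move=> r0 g0; rewrite dotZl dotZr mulrA divff // mul1r dot_tri_vinv // dotC.
Qed.

(* [X df X - (a - b) dX] for [X = a ub - b ua], where [x = df]. *)
Lemma tri_vertex_quadratic a b (ua ub x : 'rV[R]_n) :
  tri (a *: ub - b *: ua) x - (a - b) *: (a *: tri ub x - b *: tri ua x) =
  (a * b) *: tri (ub - ua) x.
Proof.
rewrite tri.unlock; apply/rowP => i; rewrite !mxE !dotE (dotC ub ua); ring.
Qed.

(** The hypothesis gives (c X^-1 - u^-1) u = - a X^-1 e and u (c X^-1 - u^-1) = - a e X^-1, which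
    are the two halves of the sandwich. *)
Lemma tri_vertex a c (u X e x : 'rV[R]_n) : u != 0 -> X != 0 ->
  c *: u - X = - (a *: e) ->
  tri (c *: vinv X - vinv u) (tri u x) = (a * a) *: tri (vinv X) (tri e x).
Proof.
move=> u0 X0 XE; have UX := cvec_unit X0; have Uu := cvec_unit u0.
have cXE : c *: cvec u - cvec X = - (a *: cvec e).
  by rewrite -!cvecZ -!cvecN -cvecD XE.
have hl : cvec (c *: vinv X - vinv u) * cvec u = - (a *: ((cvec X)^-1 * cvec e)).
  rewrite cvecD cvecN cvecZ !cvec_vinv mulrBl mulVr // -scalerAl.
  by rewrite -[X in _ - X](mulVr UX) scalerAr -mulrBr cXE mulrN scalerAr.
have hr : cvec u * cvec (c *: vinv X - vinv u) = - (a *: (cvec e / cvec X)).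
  rewrite cvecD cvecN cvecZ !cvec_vinv mulrBr mulrV // -scalerAr.
  by rewrite -[X in _ - X](mulrV UX) scalerAl -mulrBl cXE mulNr scalerAl.
have assoc (p q y : clifford R n) : p * (q * y * q) * p = (p * q) * y * (q * p).
  by rewrite !mulrA.
apply: cvec_inj; rewrite cvecZ !cvec_tri cvec_vinv assoc hl hr assoc.
by rewrite mulNr mulrNN -!scalerAl -scalerAr scalerA.
Qed.

End DualAlgebra.

(** * Darboux transforms are isothermic, and they permute *)

Section DarbouxTransforms.
Variables (R : realType) (n : nat).
Local Notation plane := (R * R)%type.
Local Notation vec := 'rV[R]_n.
Implicit Types (M U : set plane) (Q : plane -> R[i]) (f g fc : plane -> vec).
Implicit Types (z X Y : plane) (a b r : R).

(* The Christoffel transform [f^c + (r g)^-1] of [f' = f + g]. *)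
Definition dual r f fc f' : plane -> vec := fun z => fc z + r^-1 *: vinv (f' z - f z).

Lemma smooth_dual U r f fc f' : open U -> smooth U f -> smooth U fc -> smooth U f' ->
  (forall z, U z -> f' z != f z) -> smooth U (dual r f fc f').
Proof.
move=> oU sf sfc sf' ff'; apply: smoothD => //; apply: smoothZ => //.
apply: smooth_vinv => // [z Uz|]; first by rewrite subr_eq0 ff'.
exact: smoothB.
Qed.

(** The two terms in df^c cancel, so f and f^c exchange roles: df' is a sandwich of df^c by g, and
    the dual differential one of df by g^-1. *)
Lemma derive_dual U Q r f fc f' z X : isothermic_pair U Q f fc -> r != 0 ->
  darboux_pair U r f fc f' -> U z -> f' z != f z ->
  'D_X (dual r f fc f') z = r^-1 *: tri (vinv (f' z - f z)) ('D_X f z).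
Proof.
move=> pf r0 df' Uz ff'; have [sf sfc] := isothermic_pair_smooth pf.
have Du := is_derive_vinvB X pf df' Uz ff'.
have Dc : is_derive z X fc _ := derivableP (smooth_derivable sfc Uz).
have D : is_derive z X (dual r f fc f') ('D_X fc z +
    r^-1 *: (tri (vinv (f' z - f z)) ('D_X f z) - r *: 'D_X fc z)).
  exact: is_deriveD Dc (is_deriveZ r^-1 Du).
rewrite (@derive_val _ _ _ _ _ _ _ D); move: ('D_X fc z) (tri _ _) => c t.
by rewrite scalerBr scalerA mulVf // scale1r addrC subrK.
Qed.

(** The factor is (A^2 + B^2) / l = 4 |Q|^2 / l, positive because Q does not vanish. *)
Lemma isothermic_pair_dual_conformal U Q f fc z : isothermic_pair U Q f fc -> U z ->
  exists2 m, 0 < m &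
    forall X Y, dot (dform fc z X) (dform fc z Y) = m * (X.1 * Y.1 + X.2 * Y.2).
Proof.
move=> pf Uz; have [_ /smooth_differentiable/(_ z Uz) dfc] := isothermic_pair_smooth pf.
have [l [A [B [lp conf sE tE QE]]]] := isothermic_pair_frame pf Uz.
have Q0 : Q z != 0 by case: pf => _ _; apply.
have xx := conf (1, 0) (1, 0); have yy := conf (0, 1) (0, 1).
have xy := conf (1, 0) (0, 1).
rewrite /= !(mulr0, mulr1, addr0, add0r) in xx yy xy.
have [ss tt st] := frame_dual (lt0r_neq0 lp) xx yy xy sE tE.
exists ((A ^+ 2 + B ^+ 2) / l) => [|X Y].
  rewrite divr_gt0 // lt_def addr_ge0 ?sqr_ge0 // andbT.
  apply: contra Q0; rewrite paddr_eq0 ?sqr_ge0 // !sqrf_eq0 QE => /andP[/eqP-> /eqP->].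
  by rewrite oppr0 !mul0r.
rewrite (dform_linear X dfc) (dform_linear Y dfc).
move: ss tt st; move: (dform fc z (1, 0)) (dform fc z (0, 1)) => s t ss tt st.
by rewrite !dotE ss tt st (dotC t) st; ring.
Qed.

Lemma darboux_isothermic U Q r f fc f' : open U -> isothermic_pair U Q f fc ->
  r != 0 -> darboux_pair U r f fc f' -> (forall z, U z -> f' z != f z) ->
  isothermic_pair U Q f' (dual r f fc f').
Proof.
move=> oU pf r0 df ff'; have [sf sfc] := isothermic_pair_smooth pf.
have [sf' df'] := df.
have chr : christoffel U Q f' (dual r f fc f').
  split=> [|z X Y Uz|z Uz]; first exact: smooth_dual.
    rewrite /clifford_wedge /dform !(derive_dual _ pf r0 df Uz (ff' z Uz)) !df' //.
    have [_ [_ w _] _] := pf; have := w z X Y Uz; rewrite /clifford_wedge /dform.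
    move/eqP; rewrite subr_eq0 => /eqP e.
    have g0 : f' z - f z != 0 by rewrite subr_eq0 ff'.
    move: e; move: ('D_X f z) ('D_Y f z) ('D_X fc z) ('D_Y fc z) => x y s t e.
    by rewrite (tri_wedge r0 g0 e) subrr.
  have [_ [_ _ q] _] := pf; rewrite -(q z Uz) !form20E /dform.
  rewrite !(derive_dual _ pf r0 df Uz (ff' z Uz)) !df' //.
  have g0 : f' z - f z != 0 by rewrite subr_eq0 ff'.
  move: ('D_(1, 0) f z) ('D_(0, 1) f z) ('D_(1, 0) fc z) ('D_(0, 1) fc z) => x y s t.
  rewrite !dot_tri_dual //.
  by congr (_ +i* (- _ / _)); rewrite addrC.
split=> //; last by case: pf.
split=> // [z Uz|z Uz _ X|]; last by exists (dual r f fc f').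
  have [m m0 conf] := isothermic_pair_dual_conformal pf Uz.
  exists ((r * dot (f' z - f z) (f' z - f z)) ^+ 2 * m).
    by rewrite mulr_ge0 ?sqr_ge0 // ltW.
  move=> X Y; rewrite /dform !df' // dotZl dotZr dot_tri.
  by have := conf X Y; rewrite /dform => ->; ring.
rewrite /dform df' // => /eqP; rewrite scaler_eq0 (negPf r0) /=.
rewrite tri_eq0 ?subr_eq0 ?ff' // => /eqP X0.
have [m m0 conf] := isothermic_pair_dual_conformal pf Uz.
have := conf X X; rewrite /dform X0 dot0l => /esym/eqP.
rewrite mulf_eq0 (gt_eqF m0) /= paddr_eq0 -?expr2 ?sqr_ge0 // !sqrf_eq0.
by case: X {X0} => x y /= /andP[/eqP-> /eqP->].
Qed.

(** With X = a ub - b ua and e = ub - ua, both sides equal a b X^-1 e df e X^-1: the left by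
    [tri_vertex_quadratic], the right by [tri_vertex]. *)
Lemma permutability U Q a b f fc fa fb : open U -> isothermic_pair U Q f fc ->
  a != 0 -> b != 0 -> darboux_pair U a f fc fa -> darboux_pair U b f fc fb ->
  (forall z, U z -> generic_corner a b (f z) (fa z) (fb z)) ->
  darboux_pair U b fa (dual a f fc fa) (fun z => vertex a b (f z) (fa z) (fb z)).
Proof.
move=> oU pf a0 b0 da db gen; have [sf sfc] := isothermic_pair_smooth pf.
split=> [|z X Uz]; first by apply: smooth_vertex => //; [case: da|case: db].
have [fa0 fb0 fab X0] := gen z Uz; rewrite -subr_eq0 in X0.
have Da := is_derive_vinvB X pf da Uz fa0.
have Db := is_derive_vinvB X pf db Uz fb0.
have Df : is_derive z X f _ := derivableP (smooth_derivable sf Uz).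
rewrite (derive_dual X pf a0 da Uz fa0).
have DX : is_derive z X (fun w => a *: vinv (fb w - f w) - b *: vinv (fa w - f w)) _ :=
  is_deriveB (is_deriveZ a Db) (is_deriveZ b Da).
have DV := is_derive_vinv X0 DX.
have DP := is_deriveD Df (is_deriveZ (a - b) DV).
rewrite [LHS](@derive_val _ _ _ _ _ _ _ DP) /vertex {Da Db Df DX DV DP}.
rewrite -subr_eq0 in fa0.
have -> : f z + (a - b) *: vinv (a *: vinv (fb z - f z) - b *: vinv (fa z - f z)) - fa z =
    (a - b) *: vinv (a *: vinv (fb z - f z) - b *: vinv (fa z - f z)) - vinv (vinv (fa z - f z)).
  by rewrite vinvK opprB addrCA addrA.
have u0 : vinv (fa z - f z) != 0 by rewrite vinv_eq0.
move: ('D_X f z) ('D_X fc z) (vinv (fa z - f z)) (vinv (fb z - f z)) X0 u0 => p q ua ub X0 ua0.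
rewrite triZr (@tri_vertex _ _ a _ _ _ (ub - ua)) //; last first.
  by apply/rowP => i; rewrite !mxE; ring.
have -> : a *: (tri ub p - b *: q) - b *: (tri ua p - a *: q) = a *: tri ub p - b *: tri ua p.
  by apply/rowP => i; rewrite !mxE; ring.
(* Writing df as the sandwich by X^-1 of X df X puts the whole left-hand side under a single
   sandwich. *)
rewrite scalerN -[(a - b) *: tri _ _]triZr -{1}[p](trivK _ X0) -triBr.
rewrite tri_vertex_quadratic triZr !scalerA.
by congr (_ *: _); field.
Qed.

End DarbouxTransforms.

(** * Genericity *)

Section Nondegeneracy.
Variables (R : realType) (n : nat).
Local Notation plane := (R * R)%type.
Local Notation vec := 'rV[R]_n.
Implicit Types (U : set plane) (f fc fa fb fd : plane -> vec).
Implicit Types (z X Y : plane) (a b c al be ga : R).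

(** Clearing denominators between the two affine coordinates leaves a common factor [a]. The
    remaining relation is cyclic in the three points, so it also governs vertices sharing another
    edge. *)
Lemma vertex_inj a b c (f fa fb fd : vec) : a != 0 -> ~ (a = b /\ a = c) ->
  generic_corner a b f fa fb -> generic_corner a c f fa fd ->
  vertex a b f fa fb = vertex a c f fa fd ->
  (b - c) *: vinv (fa - f) + (c - a) *: vinv (fb - f) + (a - b) *: vinv (fd - f) = 0.
Proof.
move=> a0 abc gb gc; have [_ _ _ X0] := gb; have [_ _ _ Y0] := gc.
have vne c' (g : vec) : a != c' -> a *: vinv (g - f) != c' *: vinv (fa - f) ->
    vertex a c' f fa g != f.
  rewrite -subr_eq0 => ac'; rewrite -subr_eq0 => Z0.
  by rewrite -subr_eq0 /vertex addrC addrA addNr add0r scaler_eq0 (negPf ac') vinv_eq0.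
have [ab|ab] := eqVneq a b.
  rewrite -ab vertex_diag => /esym/eqP; have [ac|ac] := eqVneq a c.
    by case: abc.
  by rewrite (negPf (vne c _ ac Y0)).
have [ac|ac] := eqVneq a c.
  by rewrite -ac vertex_diag => /eqP; rewrite (negPf (vne b _ ab X0)).
move=> /(congr1 (fun y => vinv (y - f))); rewrite !vinv_vertexB //.
move: (vinv (fa - f)) (vinv (fb - f)) (vinv (fd - f)) => x y w /rowP E.
apply/rowP => i; have := E i; rewrite !mxE => {}E.
have ab0 : a - b != 0 by rewrite subr_eq0.
have ac0 : a - c != 0 by rewrite subr_eq0.
apply: (mulfI a0); rewrite mulr0.
have : (a - b) * (a - c) * ((a - b)^-1 * (a * y 0 i - b * x 0 i)) =
  (a - b) * (a - c) * ((a - c)^-1 * (a * w 0 i - c * x 0 i)) by rewrite E.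
rewrite [(a - b) * _ * _](_ : _ = (a - c) * (a * y 0 i - b * x 0 i)); last by field.
rewrite [(a - b) * _ * _](_ : _ = (a - b) * (a * w 0 i - c * x 0 i)); last by field.
move=> /eqP; rewrite -subr_eq0 => /eqP {}E; rewrite -[RHS]oppr0 -E; ring.
Qed.

(** The condition on al, be, ga makes the df^c terms of the derivative cancel, so only the
    sandwiches of df survive. *)
Lemma inverse_relation U Q a b c al be ga f fc fa fb fd : open U ->
  isothermic_pair U Q f fc ->
  darboux_pair U a f fc fa -> darboux_pair U b f fc fb -> darboux_pair U c f fc fd ->
  (forall z, U z -> [/\ fa z != f z, fb z != f z & fd z != f z]) ->
  al * a + be * b + ga * c = 0 ->
  (forall z, U z -> al *: vinv (fa z - f z) + be *: vinv (fb z - f z) +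
                    ga *: vinv (fd z - f z) = 0) ->
  forall z X, U z -> al *: tri (vinv (fa z - f z)) ('D_X f z) +
    be *: tri (vinv (fb z - f z)) ('D_X f z) + ga *: tri (vinv (fd z - f z)) ('D_X f z) = 0.
Proof.
move=> oU pf da db dd neq coef rel z X Uz; have [fa0 fb0 fd0] := neq z Uz.
have Da := is_derive_vinvB X pf da Uz fa0.
have Db := is_derive_vinvB X pf db Uz fb0.
have Dd := is_derive_vinvB X pf dd Uz fd0.
have D := is_deriveD (is_deriveD (is_deriveZ al Da) (is_deriveZ be Db)) (is_deriveZ ga Dd).
have := @near_eq_derive _ _ _ _ (cst 0) z X (near_open oU rel Uz).
rewrite derive_cst [LHS](@derive_val _ _ _ _ _ _ _ D).
move: ('D_X f z) ('D_X fc z) => p q; rewrite !scalerBr !scalerA.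
move: (tri _ p) (tri _ p) (tri _ p) => x y w /rowP E; apply/rowP => i.
move: (E i); rewrite !mxE => {}E; rewrite -[RHS]E.
apply/eqP; rewrite -subr_eq0; apply/eqP.
by rewrite -[RHS](mul0r (q 0 i)) -coef; ring.
Qed.

Lemma isothermic_pair_derive_neq0 U Q f fc z : isothermic_pair U Q f fc -> U z ->
  'D_(1, 0) f z != 0.
Proof.
move=> [[_ _ imm _] _ Q0] Uz; apply/eqP => D0.
by have [] := imm z Uz (Q0 z Uz) (1, 0) D0; apply/eqP; rewrite oner_eq0.
Qed.

(** If a ub = b ua on all of U, the derived relation forces b^2 / a = b, hence a = b and ua = ub. *)
Lemma exists_generic_corner U Q a b f fc fa fb z0 : open U -> U z0 ->
  isothermic_pair U Q f fc -> a != 0 -> b != 0 ->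
  darboux_pair U a f fc fa -> darboux_pair U b f fc fb ->
  (forall z, U z -> [/\ fa z != f z, fb z != f z & fa z != fb z]) ->
  exists2 z, U z & a *: vinv (fb z - f z) != b *: vinv (fa z - f z).
Proof.
move=> oU Uz0 pf a0 b0 da db neq; apply: contrapT => none.
have rel z : U z -> a *: vinv (fb z - f z) = b *: vinv (fa z - f z).
  by move=> Uz; apply: contrapT => /eqP h; apply: none; exists z.
have [fa0 fb0 fab] := neq z0 Uz0.
have neq3 z : U z -> [/\ fa z != f z, fb z != f z & fb z != f z].
  by move=> /neq [].
(* A two-term relation, padded by repeating [fb] with coefficient 0. *)
have coef : - b * a + a * b + 0 * b = 0 by ring.
have rel3 z : U z -> - b *: vinv (fa z - f z) + a *: vinv (fb z - f z) +
    0 *: vinv (fb z - f z) = 0.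
  by move=> /rel ->; rewrite scale0r addr0 scaleNr addNr.
have := inverse_relation oU pf da db db neq3 coef rel3 (1, 0) Uz0.
have p0 := isothermic_pair_derive_neq0 pf Uz0; have ab := rel z0 Uz0.
have ua0 : vinv (fa z0 - f z0) != 0 by rewrite vinv_eq0 subr_eq0.
have uab : vinv (fa z0 - f z0) != vinv (fb z0 - f z0).
  by rewrite (inj_eq (@vinv_inj _ _)) (inj_eq (addIr _)).
move: ('D_(1, 0) f z0) (vinv _) (vinv _) p0 ab ua0 uab => p ua ub p0 ab ua0 uab.
have -> : ub = (b / a) *: ua by rewrite mulrC -scalerA -ab scalerA mulVf ?scale1r.
rewrite triZl scale0r addr0 scalerA -scalerDl => /eqP.
rewrite scaler_eq0 tri_eq0 // (negPf p0) orbF => /eqP ba.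
have {}ba : a = b.
  apply/eqP; rewrite -subr_eq0 -(mulrI_eq0 _ (mulfI b0)) -oppr_eq0.
  rewrite -(mulrI_eq0 _ (mulfI (invr_neq0 a0))) -ba; apply/eqP; field.
  by [].
by case/eqP: uab; apply: (scalerI a0); rewrite ab ba.
Qed.

(** Eliminating [w] between the relation and its derivative leaves (b - c)(a - c)(x - y) p (x - y) =
    0. So c equals a or b, and the linear relation then makes either two points or all three
    parameters coincide. *)
Lemma exists_inverse_independent U Q a b c f fc fa fb fd z0 : open U -> U z0 ->
  isothermic_pair U Q f fc -> ~ (a = b /\ b = c) ->
  darboux_pair U a f fc fa -> darboux_pair U b f fc fb -> darboux_pair U c f fc fd ->
  (forall z, U z -> [/\ fa z != f z, fb z != f z & fd z != f z]) ->
  (forall z, U z -> [/\ fa z != fb z, fa z != fd z & fb z != fd z]) ->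
  exists2 z, U z & (b - c) *: vinv (fa z - f z) + (c - a) *: vinv (fb z - f z) +
                   (a - b) *: vinv (fd z - f z) != 0.
Proof.
move=> oU Uz0 pf abc da db dd neq neq'; apply: contrapT => none.
have rel z : U z -> (b - c) *: vinv (fa z - f z) + (c - a) *: vinv (fb z - f z) +
                   (a - b) *: vinv (fd z - f z) = 0.
  by move=> Uz; apply: contrapT => /eqP h; apply: none; exists z.
have [fab fad fbd] := neq' z0 Uz0.
have coef : (b - c) * a + (c - a) * b + (a - b) * c = 0 by ring.
have := inverse_relation oU pf da db dd neq coef rel (1, 0) Uz0.
have p0 := isothermic_pair_derive_neq0 pf Uz0; have := rel z0 Uz0.
have inj g h : g != h -> vinv (g - f z0) != vinv (h - f z0).
  by rewrite (inj_eq (@vinv_inj _ _)) (inj_eq (addIr _)).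
move: ('D_(1, 0) f z0) (vinv (fa _ - _)) (vinv (fb _ - _)) (vinv (fd _ - _)) p0
   (inj _ _ fab) (inj _ _ fad) (inj _ _ fbd) => p x y w p0 xy xw yw lin quad.
have wE : (a - b) *: w = - ((b - c) *: x + (c - a) *: y).
  by apply/eqP; rewrite -addr_eq0 addrC lin.
have : ((b - c) * (a - c)) *: tri (x - y) p = 0.
  have := congr1 (fun v => (a - b) *: v) quad; rewrite scaler0 => <-.
  have : ((a - b) * (a - b)) *: tri w p = tri ((b - c) *: x + (c - a) *: y) p.
    by rewrite -triZl wE triNl.
  rewrite !scalerDr !scalerA => ->; rewrite tri.unlock.
  apply/rowP => i; rewrite !mxE !dotE (dotC y x); ring.
move/eqP; rewrite scaler_eq0 tri_eq0 ?subr_eq0 // (negPf p0) orbF mulf_eq0 !subr_eq0.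
case/orP => /eqP E; apply: abc.
  have : (a - b) *: (w - y) = 0.
    by rewrite scalerBr wE E; apply/rowP => i; rewrite !mxE; ring.
  by move/eqP; rewrite scaler_eq0 !subr_eq0 [w == y]eq_sym (negPf yw) orbF => /eqP.
have : (a - b) *: (w - x) = 0.
  by rewrite scalerBr wE -E; apply/rowP => i; rewrite !mxE; ring.
move/eqP; rewrite scaler_eq0 !subr_eq0 [w == x]eq_sym (negPf xw) orbF => /eqP ab.
by rewrite -ab E.
Qed.

End Nondegeneracy.

(** * Balls as simply connected domains *)

Section ConvexOpen.
Variable R : realType.
Local Notation plane := (R * R)%type.
Implicit Types (U M : set plane) (z w : plane).

Lemma ball_segment (x z w : plane) (e t : R) : 0 <= t <= 1 ->
  ball x e z -> ball x e w -> ball x e ((1 - t) *: z + t *: w).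
Proof.
rewrite -ball_normE /ball_ /= => /andP[t0 t1] xz xw.
have -> : x - ((1 - t) *: z + t *: w) = (1 - t) *: (x - z) + t *: (x - w).
  by rewrite !scalerBr opprD addrACA -scalerDl subrK scale1r.
have t1' : 0 <= 1 - t by rewrite subr_ge0.
apply: le_lt_trans (ler_normD _ _) _; rewrite !normrZ (ger0_norm t0) (ger0_norm t1').
(* Strictness of the bound comes from the term with factor [t], so t = 0 is separate. *)
have [t00|tn] := eqVneq t 0; first by rewrite t00 subr0 mul1r mul0r addr0.
have tp : 0 < t by rewrite lt_def tn.
have -> : e = (1 - t) * e + t * e by ring.
by apply: ler_ltD; [rewrite ler_wpM2l // ltW | rewrite ltr_pM2l].
Qed.

Lemma ball_simply_connected (x : plane) (e : R) : 0 < e -> simply_connected (ball x e).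
Proof.
move=> e0; split; first by exists x; exact: ballxx.
- move=> z w Uz Uw; exists (fun t => (1 - t) *: z + t *: w); split.
  + apply: continuous_subspaceT => t.
    apply: cvgD; apply: cvgZr_tmp; last exact: cvg_id.
    by apply: cvgB; [exact: cvg_cst|exact: cvg_id].
  + by rewrite subr0 scale1r scale0r addr0.
  + by rewrite subrr scale0r scale1r add0r.
  + by move=> t t01; exact: ball_segment.
- move=> c [/subspace_continuousP cc c01 cU].
  (* Straight-line contraction of the loop to its base point. *)
  exists (fun p => (1 - p.1) *: c p.2 + p.1 *: c 0); split.
  + apply/subspace_continuousP => -[s t] [/= s01 t01].
    have c2 : c p.2 @[p --> within (`[0, 1] `*` `[0, 1]) (nbhs (s, t))] --> c t.
      apply: (@cvg_comp _ _ _ snd c _ (within `[0, 1] (nbhs t))); last exact: cc.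
      move=> W; rewrite /within /= => It.
      have N : nbhs (s, t) (fun p : R * R => `[0, 1] p.2 -> W p.2).
        exact: (@cvg_snd _ _ (nbhs s) (nbhs t) _ _ It).
      by apply: filterS N => p /= pW [_ p2]; exact: pW.
    have c1 : p.1 @[p --> within (`[0, 1] `*` `[0, 1]) (nbhs (s, t))] --> s.
      apply: cvg_within_filter.
      exact: cvg_fst.
    apply: cvgD; apply: cvgZ => //; last exact: cvg_cst.
    by apply: cvgB => //; exact: cvg_cst.
  + by move=> t _ /=; rewrite subr0 scale1r scale0r addr0.
  + by move=> t _ /=; rewrite subrr scale1r scale0r add0r.
  + by move=> s _ /=; rewrite -c01 -scalerDl subrK scale1r.
  + move=> s t s01 t01; apply: ball_segment => //; first exact: cU.
    by apply: cU; rewrite lexx ler01.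
Qed.

Lemma polarised_ball M (Q : plane -> R[i]) x (e : R) : polarised M Q -> 0 < e ->
  ball x e `<=` M -> Q x != 0 -> polarised (ball x e) Q.
Proof.
move=> [oM _ hol _] e0 UM Qx; split.
- exact: ball_open.
- exact: ball_simply_connected.
- by move=> z /UM; exact: hol.
- by exists x => //; exact: ballxx.
Qed.

End ConvexOpen.

Section Genericity.
Variables (R : realType) (n : nat).
Local Notation plane := (R * R)%type.
Implicit Types (U M : set plane) (Q : plane -> R[i]) (f g : plane -> 'rV[R]_n).

Lemma smooth_open_neq U f g : open U -> smooth U f -> smooth U g ->
  open (U `&` [set z | f z != g z]).
Proof.
move=> oU sf sg; rewrite openE => z [Uz fg].
have cfg : (fun w => f w - g w) @ z --> f z - g z.
  by apply: cvgB; [exact: smooth_continuous sf z Uz|exact: smooth_continuous sg z Uz].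
apply: filterI; first by apply: open_nbhs_nbhs; split.
have := cvgr_neq0 _ cfg; rewrite subr_eq0 => /(_ _ fg).
by apply: filterS => w; rewrite subr_eq0.
Qed.

(** Q is the (2,0)-part of df and df^c, so on M its zeros are the common zeros of two continuous
    real functions. *)
Lemma near_neq0_christoffel M Q f fc p : open M -> smooth M f -> christoffel M Q f fc ->
  M p -> Q p != 0 -> \forall z \near p, Q z != 0.
Proof.
move=> oM sf [sfc _ q] Mp Qp.
have sD (h : plane -> 'rV[R]_n) X : smooth M h -> smooth M (fun z => dform h z X).
  by move=> sh k; have [_ Dh] := sh k.+1; exact: Dh.
pose F X Y z := dot (dform f z X) (dform fc z Y).
have cF X Y : {for p, continuous (F X Y)}.
  exact: (Cn_dot 0 oM (sD f X sf) (sD fc Y sfc)).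
pose A z := F (1, 0) (1, 0) z - F (0, 1) (0, 1) z.
pose B z := F (1, 0) (0, 1) z + F (0, 1) (1, 0) z.
have QE z : M z -> (Q z == 0) = (A z == 0) && (B z == 0).
  move=> Mz; rewrite -(q z Mz) form20E eq_complex /A /B /F /=.
  by rewrite !mulf_eq0 oppr_eq0 invr_eq0 pnatr_eq0 !orbF.
have cA : A @ p --> A p by apply: cvgB; exact: cF.
have cB : B @ p --> B p by apply: cvgD; exact: cF.
have NM : \forall z \near p, M z by exact: (@near_open _ _ _ oM M).
move: (Qp); rewrite QE // negb_and => /orP[] h.
  have NA : \forall z \near p, A z != 0 by exact: (cvgr_neq0 _ cA).
  by apply: filterS2 NM NA => z Mz /negPf Az; rewrite (QE z Mz) Az.
have NB : \forall z \near p, B z != 0 by exact: (cvgr_neq0 _ cB).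
by apply: filterS2 NM NB => z Mz /negPf Bz; rewrite (QE z Mz) Bz andbF.
Qed.

End Genericity.

(** * The cube *)

Section Cube.
Variables (R : realType) (n : nat).
Local Notation plane := (R * R)%type.
Local Notation vec := 'rV[R]_n.
Implicit Types (U M W : set plane) (Q : plane -> R[i]) (f fc : plane -> vec).
Implicit Types (a b c r : R).

Lemma darboux_sub M U Q r f f' : U `<=` M -> darboux M Q r f f' -> darboux U Q r f f'.
Proof.
move=> UM [fc [g [cf sg dg f'E]]]; exists fc, g; split.
- exact: christoffel_sub cf.
- exact: smooth_sub sg.
- by move=> z X /UM; exact: dg.
- by move=> z /UM; exact: f'E.
Qed.

Lemma darboux_eq U Q r f f' f'' : (forall z, U z -> f' z = f'' z) ->
  darboux U Q r f f' -> darboux U Q r f f''.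
Proof.
move=> e [fc [g [cf sg dg f'E]]]; exists fc, g; split=> // z Uz.
by rewrite -e // f'E.
Qed.

Lemma open_refine U f g : open U -> smooth U f -> smooth U g ->
  (exists2 z, U z & f z != g z) ->
  exists W, [/\ open W, W !=set0, W `<=` U & forall z, W z -> f z != g z].
Proof.
move=> oU sf sg [z Uz fg]; exists (U `&` [set z | f z != g z]); split.
- exact: smooth_open_neq.
- by exists z.
- by move=> w [].
- by move=> w [].
Qed.

Lemma smooth_vinvB U f f' : open U -> smooth U f -> smooth U f' ->
  (forall z, U z -> f' z != f z) -> smooth U (fun z => vinv (f' z - f z)).
Proof.
move=> oU sf sf' ff'; apply: smooth_vinv => // [z Uz|]; first by rewrite subr_eq0 ff'.
exact: smoothB.
Qed.

Lemma open_generic_corner U Q a b f fc f1 f2 : open U -> U !=set0 ->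
  isothermic_pair U Q f fc -> a != 0 -> b != 0 ->
  darboux_pair U a f fc f1 -> darboux_pair U b f fc f2 ->
  (forall z, U z -> [/\ f1 z != f z, f2 z != f z & f1 z != f2 z]) ->
  exists W, [/\ open W, W !=set0, W `<=` U &
    forall z, W z -> generic_corner a b (f z) (f1 z) (f2 z)].
Proof.
move=> oU [z0 Uz0] pf a0 b0 d1 d2 neq; have [sf _] := isothermic_pair_smooth pf.
have [s1 _] := d1; have [s2 _] := d2.
have su f' : smooth U f' -> (forall z, U z -> f' z != f z) ->
    smooth U (fun z => vinv (f' z - f z)) by exact: smooth_vinvB.
have [||W [oW W0 WU Wn]] := open_refine oU _ _ (exists_generic_corner oU Uz0 pf a0 b0 d1 d2 neq).
- by apply: smoothZ => //; apply: su => // z /neq [].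
- by apply: smoothZ => //; apply: su => // z /neq [].
exists W; split=> // z Wz; have [? ? ?] := neq z (WU z Wz).
by split=> //; exact: Wn.
Qed.

Lemma permutability_sym U Q a b f fc fa fb : open U -> isothermic_pair U Q f fc ->
  a != 0 -> b != 0 -> darboux_pair U a f fc fa -> darboux_pair U b f fc fb ->
  (forall z, U z -> generic_corner a b (f z) (fa z) (fb z)) ->
  darboux_pair U a fb (dual b f fc fb) (fun z => vertex a b (f z) (fa z) (fb z)).
Proof.
move=> oU pf a0 b0 da db gen.
rewrite (_ : (fun z => _) = fun z => vertex b a (f z) (fb z) (fa z)).
  by apply: permutability pf _ _ db da _ => // z Uz; exact/generic_cornerC/gen.
by apply/funext => z; exact: vertexC.
Qed.

(** Indices list the parameters along a path from [f]: [f3] is f' and [f12] is the given fourth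
    vertex. The corner of [f], [f1], [f2] comes from the given quadrilateral. *)
Definition cube_corners r1 r2 r3 (f f1 f12 f2 f3 : vec) :=
  [/\ generic_corner r1 r3 f f1 f3, generic_corner r2 r3 f f2 f3,
      generic_corner r2 r3 f1 f12 (vertex r1 r3 f f1 f3) &
      generic_corner r1 r2 f3 (vertex r1 r3 f f1 f3) (vertex r2 r3 f f2 f3)].

Lemma open_cube_corners U Q r1 r2 r3 f fc f1 f12 f2 f3 : open U -> U !=set0 ->
  isothermic_pair U Q f fc -> r1 != 0 -> r2 != 0 -> r3 != 0 -> ~ (r1 = r2 /\ r2 = r3) ->
  darboux_pair U r1 f fc f1 -> darboux_pair U r2 f fc f2 -> darboux_pair U r3 f fc f3 ->
  darboux_pair U r2 f1 (dual r1 f fc f1) f12 ->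
  (forall z, U z -> generic_corner r1 r2 (f z) (f1 z) (f2 z) /\
     f12 z = vertex r1 r2 (f z) (f1 z) (f2 z)) ->
  (forall z, U z -> [/\ f3 z != f z, f3 z != f1 z & f3 z != f2 z]) ->
  exists W, [/\ open W, W !=set0, W `<=` U & forall z, W z ->
    cube_corners r1 r2 r3 (f z) (f1 z) (f12 z) (f2 z) (f3 z)].
Proof.
move=> oU Une pf r10 r20 r30 r123 d1 d2 d3 d12 face neq3.
have [|U1 [oU1 U1ne U1U gen13]] := open_generic_corner oU Une pf r10 r30 d1 d3.
  move=> z Uz; have [[? ? ? _] _] := face z Uz; have [? ? ?] := neq3 z Uz.
  by split=> //; rewrite eq_sym.
have := open_generic_corner oU1 U1ne (isothermic_pair_sub U1U pf) r20 r30
  (darboux_pair_sub U1U d2) (darboux_pair_sub U1U d3).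
case=> [z /U1U Uz|U2 [oU2 U2ne U2U1 gen23]].
  have [[? ? ? _] _] := face z Uz; have [? ? ?] := neq3 z Uz.
  by split=> //; rewrite eq_sym.
have U2U := subset_trans U2U1 U1U; have {}gen13 z : U2 z -> _ := fun h => gen13 z (U2U1 z h).
have {U1 oU1 U1ne U1U U2U1 d1 d2 d3 d12 pf Une oU} [pf d1 d2 d3 d12] :
    [/\ isothermic_pair U2 Q f fc, darboux_pair U2 r1 f fc f1, darboux_pair U2 r2 f fc f2,
        darboux_pair U2 r3 f fc f3 & darboux_pair U2 r2 f1 (dual r1 f fc f1) f12].
  by split; [exact: isothermic_pair_sub pf|exact: darboux_pair_sub d1
    |exact: darboux_pair_sub d2|exact: darboux_pair_sub d3|exact: darboux_pair_sub d12].
have {}face z : U2 z -> _ := fun h => face z (U2U z h).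
have {}neq3 z : U2 z -> _ := fun h => neq3 z (U2U z h).
have neq z : U2 z -> [/\ f1 z != f z, f2 z != f z & f3 z != f z].
  by move=> Uz; have [[? ? _ _] _] := face z Uz; have [? ? _] := neq3 z Uz.
have neq' z : U2 z -> [/\ f1 z != f2 z, f1 z != f3 z & f2 z != f3 z].
  move=> Uz; have [[_ _ ? _] _] := face z Uz; have [_ ? ?] := neq3 z Uz.
  by split=> //; rewrite eq_sym.
have [sf _] := isothermic_pair_smooth pf; have [[s1 _] [s2 _] [s3 _]] := And3 d1 d2 d3.
(* This single cyclic relation expresses both unwanted coincidences, f12 = f13 and f13 = f23. *)
have [|||U3 [oU3 U3ne U3U2 indep]] := @open_refine U2 (fun z =>
    (r2 - r3) *: vinv (f1 z - f z) + (r3 - r1) *: vinv (f2 z - f z) +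
    (r1 - r2) *: vinv (f3 z - f z)) (fun=> 0) oU2.
- by do 2?apply: smoothD => //; apply: smoothZ => //; apply: smooth_vinvB => // z /neq [].
- by move=> k; apply/CkE; exact: Cn_cst.
- by case: U2ne => z0 Uz0; exact: exists_inverse_independent Uz0 pf r123 d1 d2 d3 neq neq'.
pose f13 z := vertex r1 r3 (f z) (f1 z) (f3 z).
pose f23 z := vertex r2 r3 (f z) (f2 z) (f3 z).
have neq12_13 z : U3 z -> f12 z != f13 z.
  move=> Uz; have [g12 ->] := face z (U3U2 z Uz).
  apply: contra (indep z Uz) => /eqP e; apply/eqP.
  apply: vertex_inj e; [by []| |exact: g12|exact/gen13/U3U2].
  by case=> e12 e13; apply: r123; rewrite -e12 -e13.
have neq13_23 z : U3 z -> f13 z != f23 z.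
  move=> Uz; apply: contra (indep z Uz); rewrite /f13 /f23 2![vertex _ r3 _ _ _]vertexC.
  (* After the swap by [vertexC] both vertices share the edge to [f3], as [vertex_inj] requires. *)
  move=> /eqP e; apply/eqP; rewrite -[RHS](vertex_inj _ _ _ _ e) //.
  - by rewrite addrC addrA.
  - by case=> r31 r32; apply: r123; rewrite -r31 -r32.
  - exact/generic_cornerC/gen13/U3U2.
  - exact/generic_cornerC/gen23/U3U2.
have {}pf := isothermic_pair_sub U3U2 pf; have {}d12 := darboux_pair_sub U3U2 d12.
have {}d1 := darboux_pair_sub U3U2 d1; have {}d2 := darboux_pair_sub U3U2 d2.
have {}d3 := darboux_pair_sub U3U2 d3.
have g13 z : U3 z -> _ := fun h => gen13 z (U3U2 z h).
have g23 z : U3 z -> _ := fun h => gen23 z (U3U2 z h).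
have n1 z : U3 z -> f1 z != f z by move=> /U3U2 /neq [].
have n3 z : U3 z -> f3 z != f z by move=> /U3U2 /neq [].
have pf1 := darboux_isothermic oU3 pf r10 d1 n1.
have pf3 := darboux_isothermic oU3 pf r30 d3 n3.
have d13 := permutability oU3 pf r10 r30 d1 d3 g13.
have e13 := permutability_sym oU3 pf r10 r30 d1 d3 g13.
have e23 := permutability_sym oU3 pf r20 r30 d2 d3 g23.
have [|U4 [oU4 U4ne U4U3 gen1]] := open_generic_corner oU3 U3ne pf1 r20 r30 d12 d13.
  move=> z Uz; split; last exact: neq12_13.
    by have [g12 ->] := face z (U3U2 z Uz); exact: vertex_neq.
  by apply: vertex_neq => //; exact: g13.
have [z Uz|W [oW Wne WU4 gen3]] := open_generic_corner oU4 U4ne (isothermic_pair_sub U4U3 pf3)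
    r10 r20 (darboux_pair_sub U4U3 e13) (darboux_pair_sub U4U3 e23).
  split; last exact/neq13_23/U4U3.
    by rewrite vertexC; apply: vertex_neq => //; exact/generic_cornerC/g13/U4U3.
  by rewrite vertexC; apply: vertex_neq => //; exact/generic_cornerC/g23/U4U3.
exists W; split=> //; first by move=> z /WU4/U4U3/U3U2/U2U.
move=> z Wz; have U4z := WU4 z Wz; have U3z := U4U3 z U4z.
by split; [exact: g13|exact: g23|exact: gen1|exact: gen3].
Qed.

(** All edges but one come from permutability on the faces at [f] and [f3]. The edge from [f12] to
    [f123] comes from the face at [f1], and [vertex_cube] identifies its end. *)
Lemma bianchi_cube U Q r1 r2 r3 f fc f1 f12 f2 f3 : open U ->
  isothermic_pair U Q f fc -> r1 != 0 -> r2 != 0 -> r3 != 0 ->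
  darboux_pair U r1 f fc f1 -> darboux_pair U r2 f fc f2 -> darboux_pair U r3 f fc f3 ->
  darboux_pair U r2 f1 (dual r1 f fc f1) f12 ->
  (forall z, U z -> generic_corner r1 r2 (f z) (f1 z) (f2 z) /\
     f12 z = vertex r1 r2 (f z) (f1 z) (f2 z)) ->
  (forall z, U z -> cube_corners r1 r2 r3 (f z) (f1 z) (f12 z) (f2 z) (f3 z)) ->
  exists f13 f23 f123 : plane -> vec,
    [/\ darboux U Q r3 f1 f13, darboux U Q r3 f2 f23, darboux U Q r3 f12 f123 &
        bianchi U Q f3 f13 f123 f23].
Proof.
move=> oU pf r10 r20 r30 d1 d2 d3 d12 face corners.
have g13 z : U z -> generic_corner r1 r3 (f z) (f1 z) (f3 z) by move=> /corners [].
have g23 z : U z -> generic_corner r2 r3 (f z) (f2 z) (f3 z) by move=> /corners [].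
pose f13 z := vertex r1 r3 (f z) (f1 z) (f3 z).
pose f23 z := vertex r2 r3 (f z) (f2 z) (f3 z).
have g1 z : U z -> generic_corner r2 r3 (f1 z) (f12 z) (f13 z) by move=> /corners [].
have g3 z : U z -> generic_corner r1 r2 (f3 z) (f13 z) (f23 z) by move=> /corners [].
have n1 z : U z -> f1 z != f z by move=> /face [[]].
have n2 z : U z -> f2 z != f z by move=> /face [[]].
have n3 z : U z -> f3 z != f z by move=> /g13 [].
have n12 z : U z -> f12 z != f1 z by move=> /g1 [].
have n13 z : U z -> f13 z != f3 z by move=> /g3 [].
have n23 z : U z -> f23 z != f3 z by move=> /g3 [].
have pf1 := darboux_isothermic oU pf r10 d1 n1.
have pf2 := darboux_isothermic oU pf r20 d2 n2.
have pf3 := darboux_isothermic oU pf r30 d3 n3.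
have pf12 := darboux_isothermic oU pf1 r20 d12 n12.
have d13 : darboux_pair U r3 f1 _ f13 := permutability oU pf r10 r30 d1 d3 g13.
have d23 : darboux_pair U r3 f2 _ f23 := permutability oU pf r20 r30 d2 d3 g23.
have e13 : darboux_pair U r1 f3 _ f13 := permutability_sym oU pf r10 r30 d1 d3 g13.
have e23 : darboux_pair U r2 f3 _ f23 := permutability_sym oU pf r20 r30 d2 d3 g23.
have pf13 := darboux_isothermic oU pf3 r10 e13 n13.
have pf23 := darboux_isothermic oU pf3 r20 e23 n23.
pose f123 z := vertex r1 r2 (f3 z) (f13 z) (f23 z).
have d123 := permutability oU pf1 r20 r30 d12 d13 g1.
have e123 : darboux_pair U r2 f13 _ f123 := permutability oU pf3 r10 r20 e13 e23 g3.
have e123' : darboux_pair U r1 f23 _ f123 := permutability_sym oU pf3 r10 r20 e13 e23 g3.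
have n123 z : U z -> f123 z != f13 z by move=> Uz; apply: vertex_neq => //; exact: g3.
have n123' z : U z -> f123 z != f23 z.
  move=> Uz; rewrite /f123 vertexC; apply: vertex_neq => //.
  exact/generic_cornerC/g3.
have pf123 := darboux_isothermic oU pf13 r20 e123 n123.
exists f13, f23, f123; split.
- exact/(darbouxP _ _ oU pf1).
- exact/(darbouxP _ _ oU pf2).
- have := (darbouxP _ _ oU pf12).2 d123; apply: darboux_eq => z Uz.
  have [g12 f12E] := face z Uz; rewrite f12E.
  apply: vertex_cube => //; [exact: g13|exact: g23| |exact: g3].
  by rewrite -f12E; exact: g1.
- exists r1, r2; split=> //.
  + by split; [case: pf3|case: pf13|case: pf123|case: pf23].
  + by split; [exact/(darbouxP _ _ oU pf3)|exact/(darbouxP _ _ oU pf3)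
      |exact/(darbouxP _ _ oU pf13)|exact/(darbouxP _ _ oU pf23)].
  + move=> z Uz; split; first by rewrite eq_sym n13.
    * by rewrite eq_sym n23.
    * by have [] := g3 z Uz.
    * by rewrite eq_sym n123.
    * by rewrite eq_sym n123'.
  + move=> z Uz; split; first exact/concircular_vertex/g3.
    exact/cross_ratio_vertex/g3.
Qed.

End Cube.

(** * The local theorem *)

Theorem theorem2p22 (R : realType) (n : nat) (M : set (R * R))
    (Q : R * R -> R[i]) (r1 r2 r3 : R)
    (f f1 fh f2 f' : R * R -> 'rV[R]_n)
    (hM : polarised M Q)
    (hf : bianchi_with M Q r1 r2 f f1 fh f2)
    (hr3 : r3 != 0)
    (hf' : darboux M Q r3 f f')
    (hdistinct : forall z, M z -> [/\ f' z != f z, f' z != f1 z & f' z != f2 z])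
    (hr : ~ (r1 = r2 /\ r2 = r3)) :
  forall (p : R * R) (V : set (R * R)), M p -> Q p != 0 -> nbhs p V ->
  exists U : set (R * R),
    [/\ polarised U Q,
        U `<=` M `&` V &
        exists f1' f2' fh' : R * R -> 'rV[R]_n,
          [/\ darboux U Q r3 f1 f1',
              darboux U Q r3 f2 f2',
              darboux U Q r3 fh fh' &
              bianchi U Q f' f1' fh' f2']].
Proof.
move=> p V Mp Qp Vp; have oM := polarised_open hM.
have [[r10 r20] [isof _ _ _] [df1 df2 dfh _] neq cr] := hf.
have [sf _ _ [fc cf]] := isof.
pose U0 := interior (M `&` V `&` [set z | Q z != 0]).
have oU0 : open U0 by exact: open_interior.
have U0p : U0 p.
  apply: filterI; last exact: near_neq0_christoffel cf _ _.
  by apply: filterI => //; apply: open_nbhs_nbhs.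
have U0sub : U0 `<=` M `&` V `&` [set z | Q z != 0] by exact: interior_subset.
have U0M : U0 `<=` M by move=> z /U0sub [[]].
have pf : isothermic_pair U0 Q f fc.
  split=> [||z /U0sub [] //]; first exact: isothermic_sub isof.
  exact: christoffel_sub cf.
have d1 := (darbouxP _ _ oU0 pf).1 (darboux_sub U0M df1).
have d2 := (darbouxP _ _ oU0 pf).1 (darboux_sub U0M df2).
have d3 := (darbouxP _ _ oU0 pf).1 (darboux_sub U0M hf').
have n1 z : U0 z -> f1 z != f z by move=> /U0M /neq [+ _ _ _ _]; rewrite eq_sym.
have pf1 := darboux_isothermic oU0 pf r10 d1 n1.
have d12 := (darbouxP _ _ oU0 pf1).1 (darboux_sub U0M dfh).
have face z : U0 z -> generic_corner r1 r2 (f z) (f1 z) (f2 z) /\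
    fh z = vertex r1 r2 (f z) (f1 z) (f2 z).
  (* The cross-ratio condition determines [fh]: it is the fourth vertex. *)
  move=> /U0M Mz; have [? ? ? ? _] := neq z Mz; have [_ ?] := cr z Mz.
  by apply: cross_ratio_vertexP; rewrite // eq_sym.
have neq3 z : U0 z -> [/\ f' z != f z, f' z != f1 z & f' z != f2 z].
  by move=> /U0M; exact: hdistinct.
have [W [oW [z Wz] WU0 corners]] :=
  open_cube_corners oU0 (ex_intro _ p U0p) pf r10 r20 hr3 hr d1 d2 d3 d12 face neq3.
(* [W] need not be simply connected, a ball in it is. The ball lies in [V] but need not contain
   [p]. *)
have /nbhs_ballP [e e0 eW] : nbhs z W by apply: open_nbhs_nbhs.
have eU0 := subset_trans eW WU0.
exists (ball z e); split.
- apply: (polarised_ball hM e0); first exact: subset_trans eU0 U0M.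
  by have [] := U0sub z (WU0 z Wz).
- by move=> w /eU0/U0sub [].
- have oB : open (ball z e) by exact: ball_open.
  exact: bianchi_cube oB (isothermic_pair_sub eU0 pf) r10 r20 hr3
    (darboux_pair_sub eU0 d1) (darboux_pair_sub eU0 d2) (darboux_pair_sub eU0 d3)
    (darboux_pair_sub eU0 d12) (fun w Bw => face w (eU0 w Bw))
    (fun w Bw => corners w (eW w Bw)).
Qed.
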